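(* Let $\{r_i\}_{i=1}^\infty$ be the sequence of all rational numbers in lowest terms in $(0,1)$, ordered first by increasing denominator and then by increasing numerator, and let $\mathbb{P}$ be the set of primes. Let $R$ be one of the following subsequences of $\{r_i\}$ (numerators and denominators taken in lowest terms): (1) those whose numerator is in $\mathbb{N}$ and whose denominator is in $\mathbb{P}$; (2) those whose numerator is in $\mathbb{P}$ and whose denominator is in $\mathbb{N}$; (3) those whose numerator and denominator are both in $\mathbb{P}$. If the indices of the $r_i\in R$ are, in increasing order, $i_1<i_2<i_3<\cdots$, then the number whose continued fraction expansion is obtained by concatenating, in order, the finite continued fraction expansions of $r_{i_1},r_{i_2},r_{i_3},\dots$ is CF-normal.
   Context: Every $x\in[0,1)$ has a continued fraction expansion $x=\langle a_1,a_2,\dots\rangle$ with $a_i\in\mathbb{N}$; for rationals, the longer of the two finite expansions (the one ending in the digit $1$) is used. The Gauss measure is $\mu(A)=\frac{1}{\log 2}\int_A \frac{dx}{1+x}$; for a finite string $s=[d_1,\dots,d_k]$ of positive integers, $C_s=\{x\in[0,1):a_i(x)=d_i,\ 1\le i\le k\}$; $A_s(N;x)$ is the number of positions $1\le i\le N$ at which $s$ starts in the continued fraction expansion of $x$. A number is CF-normal if $A_s(N;x)/N\to\mu(C_s)$ for every finite string $s$. *)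

(* Defs.v *)
From HB Require Import structures.
From mathcomp Require Import all_boot all_order all_algebra.
From mathcomp Require Import all_classical all_reals all_analysis.
Set Implicit Arguments. Unset Strict Implicit. Unset Printing Implicit Defensive.
Import Order.TTheory GRing.Theory Num.Theory numFieldNormedType.Exports.
Local Open Scope ring_scope.
Local Open Scope classical_set_scope.

Section CF.
Variable R : realType.

Definition gauss (x : R) : R :=
  if x == 0 then 0 else x^-1 - (Num.truncn x^-1)%:R.

Definition gauss_orbit (x : R) (n : nat) : R := iter n gauss x.

(* i-th continued fraction digit a_i(x) (i >= 1) of x in [0,1), or None if
   the expansion has fewer than i digits.  For rationals the LONGER of the two
   finite expansions (the one ending in 1) is produced: the last Gauss-map
   digit a >= 2 is replaced by the two digits a-1, 1. *)
Definition cf_digit (x : R) (i : nat) : option nat :=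
  match i with
  | 0 => None
  | i'.+1 =>
    let y := gauss_orbit x i' in
    if y != 0 then
      let a := Num.truncn y^-1 in
      if gauss y == 0 then Some a.-1 else Some a
    else match i' with
         | 0 => None
         | i''.+1 => if gauss_orbit x i'' != 0 then Some 1%N else None
         end
  end.

(* the finite CF expansion (longer form) of the rational p/q, 0 < p < q:
   its length is at most q, so reading 2q digits suffices. *)
Definition cf_rat (p q : nat) : seq nat :=
  pmap (cf_digit (p%:R / q%:R)) (iota 1 (2 * q)).

Definition cylinder (s : seq nat) : set R :=
  [set x | 0 <= x < 1 /\
           forall j, (j < size s)%N -> cf_digit x j.+1 = Some (nth 0%N s j)].

Definition gauss_measure (A : set R) : R :=
  (ln 2)^-1 * fine (\int[lebesgue_measure]_(x in A) ((1 + x)^-1)%:E).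

Definition occ (s : seq nat) (N : nat) (x : R) : nat :=
  count (fun i => all (fun j => cf_digit x (i + j) == Some (nth 0%N s j))
                      (iota 0 (size s)))
        (iota 1 N).

Definition cf_normal (x : R) : Prop :=
  forall s : seq nat, all (fun d => 0 < d)%N s ->
    let u : nat -> R := fun N => (occ s N x)%:R / N%:R in
    u @ \oo --> gauss_measure (cylinder s).

Definition has_cf (x : R) (d : nat -> nat) : Prop :=
  0 <= x < 1 /\ forall i, cf_digit x i.+1 = Some (d i).

End CF.

Inductive subseq_kind := NumNat_DenPrime | NumPrime_DenNat | NumPrime_DenPrime.

Definition selR (k : subseq_kind) (p q : nat) : bool :=
  match k with
  | NumNat_DenPrime => prime q
  | NumPrime_DenNat => prime p
  | NumPrime_DenPrime => prime p && prime q
  end.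

Definition concat_prefix (R : realType) (k : subseq_kind) (Q : nat) : seq nat :=
  flatten [seq flatten [seq cf_rat R p q
                       | p <- iota 1 q.-1 & coprime p q && selR k p q]
          | q <- iota 2 Q.-1].

Definition is_concat (R : realType) (k : subseq_kind) (d : nat -> nat) : Prop :=
  forall Q i, (i < size (concat_prefix R k Q))%N ->
    d i = nth 0%N (concat_prefix R k Q) i.

(* Main.v *)
Require Import Defs.
From HB Require Import structures.
From mathcomp Require Import all_boot all_order all_algebra.
From mathcomp Require Import all_classical all_reals all_analysis.
From mathcomp Require Import measurable_realfun ring lra zify.
Set Implicit Arguments. Unset Strict Implicit. Unset Printing Implicit Defensive.
Import Order.TTheory GRing.Theory Num.Theory numFieldNormedType.Exports.
Local Open Scope ring_scope.
Local Open Scope classical_set_scope.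

(** Read backwards, the digits of an expansion form a chain with complete
connections: from the tail [x] the digit [a] is drawn with probability
[(1 + x) / ((a + x) (a + x + 1))] and the tail becomes [1 / (a + x)].  The
product of these weights along the expansion of [p / q] is at least
[1 / (2 q^2)], so the number of words [w] in a bad set whose rational has
denominator at most [Q] is at most [2 Q^2] times the probability of that set.
The transition operator contracts Lipschitz constants by 7/8 and preserves the
Gauss measure, hence the probability of seeing a string [s] after a long gap is
uniformly close to its Gauss measure, and a Chernoff bound along arithmetic
progressions makes the probability of a wrong frequency of [s] exponentially
small in the length.  Words shorter than [ln Q / 8] are few by Rankin's trick,
as [q] is at least the product of the digits.  So all but [o(Q^2 / ln^2 Q)]
rationals have about the right frequency of [s], whereas by Chebyshev's lower
bound already the pairs of primes contribute at least [Q^2 / (144 ln^2 Q)]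
rationals to each of the three sequences.

All sums are truncated to digits at most [M], so no infinite sum over digits
occurs. *)

(** * The Gauss-Kuzmin operator *)


Section GaussKuzminOperator.
Variable R : realType.
Implicit Types (x y t : R) (w s : seq nat) (f : R -> R).

(** The sequences can be as sparse as a fraction 1 / ln^2 Q of all rationals, so a statement about
    almost all rationals says nothing about them unless the exceptional set is smaller by more than
    two logarithms. This is why exponential smallness in the length, together with a length of order
    ln Q, is needed: it yields a power saving in Q. Of the primes only their number enters, never
    their distribution. Drawing digits backwards gives bounds that hold uniformly in the tail [x] in
    [0, 1]. The process has infinite memory, but a bound valid for every tail can be multiplied over
    consecutive blocks as if these were independent. Truncation at M costs mass. [gk_op_full] hands
    the lost mass to the last branch, so that coupling arguments apply; [gk_op] differs from it by
    O(n / M) after n steps. Gap and block length depend only on [s] and the tolerance, so that M can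
    finally be set to Q, which bounds every digit of the rationals in question. *)

Definition cf_eval w x : R := foldr (fun a y => (a%:R + y)^-1) x w.

(** For the expansion of [p / q] and [x = 0] the tails are ratios of consecutive Euclidean
    remainders, so this product is [1 / q]; it replaces continuants. *)
Definition cf_tails w x : R :=
  \prod_(i < size w) cf_eval (drop i w) x.

Definition digit_weight (a : nat) x : R :=
  (1 + x) / ((a%:R + x) * (a%:R + x + 1)).

Fixpoint word_weight w x : R :=
  if w is a :: w' then digit_weight a (cf_eval w' x) * word_weight w' x else 1.

(** The probability that the digit drawn from the tail [x] is at least [m]. *)
Definition digit_tail (m : nat) x : R := (1 + x) / (m%:R + x).

Definition gk_op (M : nat) f x : R :=
  \sum_(1 <= a < M.+1) digit_weight a x * f (a%:R + x)^-1.

(** Digits above [M] are sent through the branch of [M]. This makes the operator Markov, while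
    [gk_op] is the one that matches sums over words with digits at most [M]. *)
Definition gk_op_full (M : nat) f x : R :=
  gk_op M f x + digit_tail M.+1 x * f (M%:R + x)^-1.

Definition lip01 (c : R) f :=
  forall x y, 0 <= x <= 1 -> 0 <= y <= 1 -> `|f y - f x| <= c * `|y - x|.

Lemma natr_ge1 (a : nat) : (0 < a)%N -> 1 <= a%:R :> R.
Proof. by rewrite ler1n. Qed.

Lemma inv_digit_itv (a : nat) x : (0 < a)%N -> 0 <= x <= 1 ->
  0 <= (a%:R + x)^-1 <= 1.
Proof.
move=> /natr_ge1 a1 /andP[x0 x1].
rewrite invr_ge0 invf_le1; last by lra.
by apply/andP; split; lra.
Qed.

Lemma cf_eval_itv w x : all (fun d => 0 < d)%N w -> 0 <= x <= 1 ->
  0 <= cf_eval w x <= 1.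
Proof.
by elim: w => //= a w IH /andP[a0 w0] x01; apply: inv_digit_itv => //; apply: IH.
Qed.

Lemma cf_eval_cat w1 w2 x : cf_eval (w1 ++ w2) x = cf_eval w1 (cf_eval w2 x).
Proof. by rewrite /cf_eval foldr_cat. Qed.

Lemma word_weight_cat w1 w2 x :
  word_weight (w1 ++ w2) x = word_weight w1 (cf_eval w2 x) * word_weight w2 x.
Proof.
elim: w1 => [|a w1 IH] /=; first by rewrite mul1r.
by rewrite IH cf_eval_cat mulrA.
Qed.

Lemma digit_weight_ge0 a x : 0 <= x -> 0 <= digit_weight a x.
Proof.
move=> x0; rewrite /digit_weight divr_ge0 ?mulr_ge0 ?addr_ge0 ?ler0n ?ler01 //.
Qed.

Lemma word_weight_ge0 w x : all (fun d => 0 < d)%N w -> 0 <= x <= 1 ->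
  0 <= word_weight w x.
Proof.
elim: w => //= a w IH /andP[a0 w0] x01.
by rewrite mulr_ge0 ?IH // digit_weight_ge0 //; case/andP: (cf_eval_itv w0 x01).
Qed.

Lemma digit_weightE a x : (0 < a)%N -> 0 <= x ->
  digit_weight a x = digit_tail a x - digit_tail a.+1 x.
Proof.
move=> /natr_ge1 a1 x0; rewrite /digit_weight /digit_tail -natr1.
by field; apply/andP; split; lra.
Qed.

Lemma digit_tail1 x : 0 <= x -> digit_tail 1 x = 1.
Proof. by move=> x0; rewrite /digit_tail divff //; lra. Qed.

Lemma digit_tail_ge0 m x : 0 <= x -> 0 <= digit_tail m x.
Proof. by move=> x0; rewrite /digit_tail divr_ge0 // ?addr_ge0 ?ler0n ?ler01. Qed.

Lemma digit_tail_le m x : 0 <= x <= 1 -> digit_tail m.+1 x <= 2 / m.+1%:R.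
Proof.
move=> /andP[x0 x1]; have m1 := @natr_ge1 m.+1 isT.
rewrite /digit_tail ler_pdivrMr; last by lra.
rewrite mulrAC ler_pdivlMr; last by lra.
have : x * m.+1%:R <= m.+1%:R by rewrite ler_piMl //; lra.
lra.
Qed.

Lemma sum_digit_weight m M x : (0 < m)%N -> (m <= M.+1)%N -> 0 <= x ->
  \sum_(m <= a < M.+1) digit_weight a x = digit_tail m x - digit_tail M.+1 x.
Proof.
move=> m0 mM x0.
under eq_big_nat => a /andP[ma _] do
  rewrite digit_weightE ?(leq_trans m0 ma) // -[_ - _]opprB.
by rewrite sumrN telescope_sumr // opprB.
Qed.

Lemma digit_weight_le1 a x : (0 < a)%N -> 0 <= x <= 1 -> digit_weight a x <= 1.
Proof.
move=> /natr_ge1 a1 /andP[x0 x1]; rewrite /digit_weight ler_pdivrMr; nra.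
Qed.

(** * Sup norm bounds and contraction of Lipschitz constants *)

Lemma gk_op_le M f x (B : R) : 0 <= x <= 1 -> 0 <= B ->
  (forall y, 0 <= y <= 1 -> f y <= B) -> gk_op M f x <= B.
Proof.
move=> x01 B0 fB; have /andP[x0 x1] := x01.
apply: (@le_trans _ _ (\sum_(1 <= a < M.+1) digit_weight a x * B)).
  apply: ler_sum_nat => a /andP[a0 _]; apply: ler_wpM2l.
    exact: digit_weight_ge0.
  by apply: fB; apply: inv_digit_itv.
rewrite -big_distrl /= sum_digit_weight // digit_tail1 //.
have := digit_tail_ge0 M.+1 x0; nra.
Qed.

Lemma gk_op_norm_le M f x (B : R) : 0 <= x <= 1 -> 0 <= B ->
  (forall y, 0 <= y <= 1 -> `|f y| <= B) -> `|gk_op M f x| <= B.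
Proof.
move=> x01 B0 fB; have /andP[x0 x1] := x01.
apply: le_trans (ler_norm_sum _ _ _) _.
rewrite [leLHS](_ : _ = gk_op M (fun y => `|f y|) x).
  exact: gk_op_le.
by apply: eq_big_nat => a /andP[a0 _]; rewrite normrM ger0_norm // digit_weight_ge0.
Qed.

Lemma gk_opB M f (h : R -> R) x :
  gk_op M (fun y => f y - h y) x = gk_op M f x - gk_op M h x.
Proof. by rewrite /gk_op -sumrB; apply: eq_bigr => a _; rewrite mulrBr. Qed.

(** Summation by parts. As the mass above [M] reuses [g M], no boundary term is left at the top. *)
Lemma abel_digit (D g : nat -> R) M : (0 < M)%N ->
  \sum_(1 <= a < M.+1) (D a - D a.+1) * g a + D M.+1 * g M =
  D 1%N * g 1%N + \sum_(2 <= m < M.+1) D m * (g m - g m.-1).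
Proof.
case: M => // M _; elim: M => [|M IH].
  by rewrite big_nat1 big_geq //; ring.
rewrite big_nat_recr //= [in RHS]big_nat_recr //= addrA -IH; ring.
Qed.

Lemma sum_inv_cubic_le M : (0 < M)%N ->
  \sum_(2 <= m < M.+1) (m.-1%:R * m%:R * m.+1%:R)^-1 <= 4^-1 :> R.
Proof.
case: M => // M _.
suff -> : \sum_(2 <= m < M.+2) (m.-1%:R * m%:R * m.+1%:R)^-1 =
    4^-1 - (2 * M.+1%:R * M.+2%:R)^-1 :> R.
  by rewrite gerBl invr_ge0 ?mulr_ge0 ?ler0n.
elim: M => [|M IH].
  by rewrite big_geq //; field.
rewrite big_nat_recr //= IH -[M.+3%:R]natr1 -[M.+2%:R]natr1.
have := @natr_ge1 M.+1 isT => m1.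
by field; do ?[apply/andP; split]; lra.
Qed.

(* The digits drawn from x and from y > x are coupled monotonically (Abel
   summation in the tail probabilities); 5/8 bounds the contraction of the
   inverse branches and 1/4 the effect of changing the digit. *)
Lemma gk_op_full_lip M f (c : R) : (1 < M)%N -> 0 <= c -> lip01 c f ->
  lip01 (7/8 * c) (gk_op_full M f).
Proof.
move=> M1 c0 fc x y x01 y01; have /andP[x0 x1] := x01; have /andP[y0 y1] := y01.
have M0 : (0 < M)%N by apply: ltnW.
pose D m := digit_tail m y - digit_tail m x.
pose g m := f (m%:R + x)^-1.
(* The bracket keeps the digit and changes the tail; the last sum keeps the tail [x] and changes the
   digit. *)
have -> : gk_op_full M f y - gk_op_full M f x =
    (\sum_(1 <= a < M.+1) digit_weight a y * (f (a%:R + y)^-1 - g a)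
     + digit_tail M.+1 y * (f (M%:R + y)^-1 - g M))
    + \sum_(2 <= m < M.+1) D m * (g m - g m.-1).
  have := abel_digit D g M0.
  rewrite [D 1%N]/D !digit_tail1 // subrr mul0r add0r => <-.
  rewrite /gk_op_full /gk_op.
  under [X in _ = X + _ + _]eq_bigr => a _ do rewrite mulrBr.
  rewrite sumrB.
  rewrite (_ : \sum_(1 <= a < M.+1) (D a - D a.+1) * g a =
     \sum_(1 <= a < M.+1) digit_weight a y * g a -
     \sum_(1 <= a < M.+1) digit_weight a x * g a).
    rewrite /D /g; ring.
  rewrite -sumrB; apply: eq_big_nat => a /andP[a0 _].
  by rewrite !digit_weightE // /D; ring.
set d : R := `|y - x|; have d0 : 0 <= d by apply: normr_ge0.
have lipu a : (0 < a)%N -> `|f (a%:R + y)^-1 - g a| <=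
    c * d * ((a%:R + x)^-1 * (a%:R + y)^-1).
  move=> a0; have a1 := natr_ge1 a0.
  apply: le_trans (fc _ _ (inv_digit_itv a0 x01) (inv_digit_itv a0 y01)) _.
  rewrite -mulrA ler_wpM2l //.
  rewrite (_ : _ - _ = - (y - x) * ((a%:R + x)^-1 * (a%:R + y)^-1)); last first.
    by field; apply/andP; split; lra.
  by rewrite normrM normrN [X in _ * X]ger0_norm // mulr_ge0 // invr_ge0; lra.
have cd0 : 0 <= c * d by apply: mulr_ge0.
have lip1 : `|f (1%:R + y)^-1 - g 1%N| <= c * d.
  apply: le_trans (lipu 1%N isT) _; rewrite -[leRHS]mulr1 ler_wpM2l // -invfM.
  by rewrite invf_le1; nra.
have lip2 a : (1 < a)%N -> `|f (a%:R + y)^-1 - g a| <= c * d / 4.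
  move=> a1; apply: le_trans (lipu _ (ltnW a1)) _; rewrite ler_wpM2l //.
  have : 2 <= a%:R :> R by rewrite (ler_nat R 2).
  by move=> a2; rewrite -invfM lef_pV2 ?posrE; nra.
apply: le_trans (ler_normD _ _) _.
rewrite (_ : 7/8 * c * d = 5/8 * (c * d) + (c * d) * 4^-1); last by field.
apply: lerD.
  apply: le_trans (ler_normD _ _) _.
  rewrite big_nat_recl // .
  apply: le_trans (lerD (ler_normD _ _) (lexx _)) _.
  rewrite -addrA.
  (* The digit 1 has weight [1 / (2 + y) <= 1/2] and a branch with Lipschitz constant at most 1; all
     other branches contract by 1/4. The worst case is 1/2 + 1/8. *)
  have -> : 5/8 * (c * d) = 2^-1 * (c * d) + 2^-1 * (c * d / 4) by field.
  have w1 : 0 <= digit_weight 1 y <= 2^-1.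
    rewrite digit_weight_ge0 //= /digit_weight ler_pdivrMr; nra.
  apply: (@le_trans _ _ (digit_weight 1 y * (c * d) +
     (1 - digit_weight 1 y) * (c * d / 4))); last first.
    by have /andP[_ h] := w1; nra.
  apply: lerD.
    rewrite normrM ger0_norm; last by case/andP: w1.
    by apply: ler_wpM2l; [case/andP: w1|exact: lip1].
  rewrite (_ : 1 - digit_weight 1 y =
     \sum_(2 <= a < M.+1) digit_weight a y + digit_tail M.+1 y); last first.
    by rewrite sum_digit_weight // digit_weightE // digit_tail1 //; ring.
  rewrite mulrDl; apply: lerD; last first.
    by rewrite normrM ger0_norm ?digit_tail_ge0 // ler_wpM2l ?digit_tail_ge0 ?lip2.
  apply: le_trans (ler_norm_sum _ _ _) _.
  rewrite big_distrl /= [leRHS]big_add1 /=.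
  apply: ler_sum_nat => a /andP[a0 _].
  by rewrite normrM ger0_norm ?digit_weight_ge0 // ler_wpM2l ?digit_weight_ge0 ?lip2.
apply: le_trans (ler_norm_sum _ _ _) _.
apply: le_trans (ler_wpM2l cd0 (sum_inv_cubic_le M0)).
rewrite big_distrr /=; apply: ler_sum_nat => -[|[|m]] // _.
rewrite normrM /=.
have m1 := @natr_ge1 m.+1 isT.
have -> : D m.+2 = (y - x) * (m.+1%:R / ((m.+2%:R + x) * (m.+2%:R + y))).
  rewrite /D /digit_tail -[m.+2%:R]natr1; field.
  by apply/andP; split; lra.
have : `|g m.+2 - g m.+1| <= c * ((m.+2%:R + x) * (m.+1%:R + x))^-1.
  apply: le_trans (fc _ _ (inv_digit_itv _ x01) (inv_digit_itv _ x01)) _ => //.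
  rewrite ler_wpM2l // -[m.+2%:R]natr1 ler_norml.
  rewrite (_ : _ - _ = - ((m.+1%:R + 1 + x) * (m.+1%:R + x))^-1); last first.
    by field; apply/andP; split; lra.
  rewrite lexx /= -subr_ge0 opprK addr_ge0 // invr_ge0 mulr_ge0 //; lra.
move=> hg; rewrite normrM -/d [`|_ / _|]ger0_norm; last first.
  by rewrite divr_ge0 ?mulr_ge0 //; lra.
apply: le_trans (ler_wpM2l _ hg) _.
  by rewrite mulr_ge0 // divr_ge0 ?mulr_ge0 //; lra.
rewrite (_ : d * _ * _ = c * d * (m.+1%:R / ((m.+2%:R + x) * (m.+2%:R + y)) *
  ((m.+2%:R + x) * (m.+1%:R + x))^-1)); last by ring.
rewrite ler_wpM2l // ler_pdivrMr; last by rewrite mulr_gt0 //; lra.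
rewrite -[m.+3%:R]natr1 -[m.+2%:R]natr1.
set z : R := m.+1%:R in m1 *.
rewrite ler_pdivrMr; last by rewrite mulr_gt0 //; lra.
rewrite -mulrA mulrC ler_pdivlMr; last by rewrite !mulr_gt0 //; lra.
(* The core is [z * (z + 2) <= (z + 1) ^ 2]; [x] and [y] only enlarge the right side. *)
rewrite (_ : z * _ = ((z + 1) * z) * (z * (z + 1 + 1))); last by ring.
apply: ler_pM; [nra | nra | | nra].
by apply: ler_pM; lra.
Qed.

Lemma iter_gk_op_full_lip M f (c : R) n : (1 < M)%N -> 0 <= c -> lip01 c f ->
  lip01 ((7/8) ^+ n * c) (iter n (gk_op_full M) f).
Proof.
move=> M1 c0 fc; elim: n => [|n IH]; first by rewrite expr0 mul1r.
rewrite exprS -mulrA; apply: gk_op_full_lip => //.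
by rewrite mulr_ge0 // exprn_ge0 //; lra.
Qed.

Lemma gk_op_full_norm_le M f x (B : R) : (0 < M)%N -> 0 <= x <= 1 ->
  (forall y, 0 <= y <= 1 -> `|f y| <= B) -> `|gk_op_full M f x| <= B.
Proof.
move=> M0 x01 fB; have /andP[x0 x1] := x01.
have -> : B = (\sum_(1 <= a < M.+1) digit_weight a x) * B + digit_tail M.+1 x * B.
  by rewrite sum_digit_weight // digit_tail1 //; ring.
apply: le_trans (ler_normD _ _) _; apply: lerD; last first.
  rewrite normrM ger0_norm ?digit_tail_ge0 // ler_wpM2l ?digit_tail_ge0 //.
  by apply: fB; apply: inv_digit_itv.
apply: le_trans (ler_norm_sum _ _ _) _; rewrite big_distrl /=.
apply: ler_sum_nat => a /andP[a0 _].
rewrite normrM ger0_norm ?digit_weight_ge0 // ler_wpM2l ?digit_weight_ge0 //.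
by apply: fB; apply: inv_digit_itv.
Qed.

Lemma iter_gk_op_norm_le M f (B : R) n : 0 <= B ->
  (forall y, 0 <= y <= 1 -> `|f y| <= B) ->
  forall x, 0 <= x <= 1 -> `|iter n (gk_op M) f x| <= B.
Proof.
move=> B0 fB; elim: n => [|n IH] x x01 /=; first exact: fB.
exact: gk_op_norm_le.
Qed.

(** Each step differs by at most the tail mass [2 / (M + 1)] times [B], and earlier errors do not
    grow because [gk_op] does not increase the sup norm. *)
Lemma iter_gk_op_full_sub M f (B : R) n : (0 < M)%N -> 0 <= B ->
  (forall y, 0 <= y <= 1 -> `|f y| <= B) ->
  forall x, 0 <= x <= 1 ->
  `|iter n (gk_op_full M) f x - iter n (gk_op M) f x| <= n%:R * (2 * B / M.+1%:R).
Proof.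
move=> M0 B0 fB; elim: n => [|n IH] x x01 /=; first by rewrite subrr normr0 mul0r.
have fullB y : 0 <= y <= 1 -> `|iter n (gk_op_full M) f y| <= B.
  elim: n {IH} y => [|n IH] y y01 /=; first exact: fB.
  exact: gk_op_full_norm_le.
rewrite {1}/gk_op_full addrAC -gk_opB -natr1 mulrDl mul1r.
apply: le_trans (ler_normD _ _) _; apply: lerD.
  apply: gk_op_norm_le => //.
  by rewrite mulr_ge0 // divr_ge0 // mulr_ge0.
have /andP[x0 x1] := x01.
rewrite normrM ger0_norm ?digit_tail_ge0 // [leRHS]mulrAC; apply: ler_pM => //.
- exact: digit_tail_ge0.
- exact: digit_tail_le.
- by apply: fullB; apply: inv_digit_itv.
Qed.

(** * Invariance of the Gauss measure, expressed by primitives *)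

Lemma is_derive_addl (c x : R) : is_derive x 1 (fun y : R => c + y) 1.
Proof.
by have := is_deriveD (is_derive_cst c x 1) (is_derive_id x 1); rewrite add0r.
Qed.

Lemma is_derive_ln1D x : -1 < x -> is_derive x 1 (fun y : R => ln (1 + y)) (1 + x)^-1.
Proof.
move=> x1; have h : is_derive (1 + x) 1 (@ln R) (1 + x)^-1 by apply: is_derive1_ln; lra.
by have := is_derive1_comp h (is_derive_addl 1 x); rewrite mulr1.
Qed.

(* The domain extends below 0 so that one-sided derivatives never occur. *)
Definition gauss_primitive (F f : R -> R) :=
  forall x, - 2^-1 < x -> is_derive x 1 F (f x / (1 + x)).

(** Monotonicity of the integral against [dx / (1 + x)], from the mean value theorem for
    [F - c * ln (1 + y)]; no integral has to be formed. *)
Lemma gauss_primitive_le F f (c a b : R) : gauss_primitive F f ->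
  0 <= a -> a <= b -> b <= 1 ->
  (forall x, 0 <= x <= 1 -> f x <= c) -> F b - F a <= c * (ln (1 + b) - ln (1 + a)).
Proof.
move=> Ff a0 ab b1 fc.
have dl x : - 2^-1 < x -> is_derive x 1 (fun y => c * ln (1 + y)) (c * (1 + x)^-1).
  by move=> x0; apply: (is_deriveZ c); apply: is_derive_ln1D; lra.
have dG x : - 2^-1 < x ->
    is_derive x 1 (fun y => F y - c * ln (1 + y)) (f x / (1 + x) - c * (1 + x)^-1).
  move=> x0; have := Ff x x0; have := dl x x0 => h1 h2.
  exact: is_deriveB.
have [] := @MVT_segment R (fun y => F y - c * ln (1 + y))
   (fun x => f x / (1 + x) - c * (1 + x)^-1) a b ab.
- by move=> x; rewrite in_itv /= => /andP[ax _]; apply: dG; lra.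
- apply: derivable_within_continuous => x; rewrite in_itv /= => /andP[ax _].
  by apply: ex_derive; apply: dG; lra.
move=> x; rewrite in_itv /= => /andP[ax xb].
have -> : F b - c * ln (1 + b) - (F a - c * ln (1 + a)) =
  F b - F a - c * (ln (1 + b) - ln (1 + a)) by ring.
move=> h; rewrite -subr_le0 h -mulrBl.
have fx : f x - c <= 0 by rewrite subr_le0; apply: fc; lra.
rewrite mulr_le0_ge0 ?mulr_le0_ge0 ?invr_ge0 ?subr_ge0 //; lra.
Qed.

Lemma gauss_primitiveN F f : gauss_primitive F f ->
  gauss_primitive (fun x => - F x) (fun x => - f x).
Proof. by move=> Ff x x0; rewrite mulNr; apply: is_deriveN; apply: Ff. Qed.

Lemma gauss_primitive_norm_le F f (c a b : R) : gauss_primitive F f ->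
  0 <= a -> a <= b -> b <= 1 ->
  (forall x, 0 <= x <= 1 -> `|f x| <= c) ->
  `|F b - F a| <= c * (ln (1 + b) - ln (1 + a)).
Proof.
move=> Ff a0 ab b1 fc; rewrite ler_norml; apply/andP; split.
  rewrite lerNl opprB.
  have -> : F a - F b = - F b - - F a by ring.
  apply: (gauss_primitive_le (gauss_primitiveN Ff)) => // x /fc.
  by apply: le_trans; rewrite -normrN ler_norm.
apply: (gauss_primitive_le Ff) => // x /fc; apply: le_trans; exact: ler_norm.
Qed.

(** Change of variables [t = 1 / (a + x)], under which [dt / (1 + t)] becomes
    [digit_weight a x * dx / (1 + x)]; the minus sign is there because the branch is decreasing. *)
Lemma gauss_primitive_digit F f a : (0 < a)%N -> gauss_primitive F f ->
  gauss_primitive (fun x => - F (a%:R + x)^-1)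
                  (fun x => digit_weight a x * f (a%:R + x)^-1).
Proof.
move=> a0 Ff x x0; have a1 := natr_ge1 a0.
have ax : a%:R + x != 0 by lra.
have h3 := is_deriveV ax (is_derive_addl a%:R x).
have h4 : - 2^-1 < (a%:R + x)^-1.
  by apply: (@lt_trans _ _ 0); [lra | rewrite invr_gt0; lra].
have h5 := is_deriveN (@is_derive1_comp R F (fun y => (a%:R + y)^-1) x _ _ (Ff _ h4) h3).
rewrite (_ : _ * _ / _ =
  - (f (a%:R + x)^-1 / (1 + (a%:R + x)^-1) * (- (a%:R + x) ^- 2 *: 1))) //.
rewrite /digit_weight /GRing.scale /= mulr1; field.
by do ?[apply/andP; split]; lra.
Qed.

Lemma gauss_primitive_gk_op M F f : gauss_primitive F f ->
  gauss_primitive (fun x => - \sum_(1 <= a < M.+1) F (a%:R + x)^-1) (gk_op M f).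
Proof.
move=> Ff; elim: M => [|M IH] x x0.
  rewrite /gk_op big_geq // mul0r.
  rewrite (_ : (fun y => _) = cst 0); first exact: is_derive_cst.
  by apply/funext => y; rewrite big_geq // oppr0.
rewrite /gk_op big_nat_recr //= mulrDl.
rewrite (_ : (fun y => _) = (fun y => - \sum_(1 <= a < M.+1) F (a%:R + y)^-1)
   + (fun y => - F (M.+1%:R + y)^-1)).
  by apply: is_deriveD; [exact: IH | exact: gauss_primitive_digit].
by apply/funext => y; rewrite big_nat_recr //= opprD.
Qed.

(** The first [M] inverse branches tile [[1 / (M + 1), 1]], so the Gauss integral is preserved up to
    the piece next to 0. *)
Lemma gauss_primitive_gk_op_span M (F : R -> R) :
  (- \sum_(1 <= a < M.+1) F (a%:R + 1)^-1) - (- \sum_(1 <= a < M.+1) F (a%:R + 0)^-1)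
  = F 1 - F M.+1%:R^-1.
Proof.
rewrite opprK addrC -sumrB.
under eq_bigr => a _ do rewrite natr1 addr0 -opprB.
by rewrite sumrN telescope_sumr // opprB invr1.
Qed.

Lemma ln2_ge_half : 2^-1 <= ln 2 :> R.
Proof.
have : ln (1 + (- 2^-1)) <= - 2^-1 :> R by apply: le_ln1Dx; lra.
have -> : 1 + (- 2^-1) = 2^-1 :> R by field.
by rewrite lnV ?posrE // lerN2.
Qed.

Lemma iter_gk_op_span M F f (B : R) n : gauss_primitive F f -> 0 <= B ->
  (forall x, 0 <= x <= 1 -> `|f x| <= B) ->
  exists2 G, gauss_primitive G (iter n (gk_op M) f) &
    `|(G 1 - G 0) - (F 1 - F 0)| <= n%:R * (B / M.+1%:R).
Proof.
move=> Ff B0 fB; elim: n => [|n [G Gf IH]].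
  by exists F => //; rewrite subrr normr0 mul0r.
exists (fun x => - \sum_(1 <= a < M.+1) G (a%:R + x)^-1).
  exact: gauss_primitive_gk_op.
rewrite gauss_primitive_gk_op_span.
have -> : G 1 - G M.+1%:R^-1 - (F 1 - F 0) =
  (G 1 - G 0 - (F 1 - F 0)) - (G M.+1%:R^-1 - G 0) by ring.
apply: le_trans (ler_normB _ _) _; rewrite -[n.+1%:R]natr1 mulrDl mul1r lerD //.
have M1 : 0 < M.+1%:R^-1 :> R by rewrite invr_gt0 ltr0n.
have M2 : M.+1%:R^-1 <= 1 :> R by rewrite invf_le1 ?ltr0n // natr_ge1.
have := gauss_primitive_norm_le Gf (lexx 0) (ltW M1) M2
  (@iter_gk_op_norm_le M f B n B0 fB).
move=> /le_trans; apply.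
rewrite addr0 ln1 subr0 ler_wpM2l //; apply: le_ln1Dx.
by apply: lt_trans M1; rewrite oppr_lt0 ltr01.
Qed.

(** Contraction makes the iterate nearly constant and invariance fixes its Gauss mean; a function
    oscillating by at most [d] lies within [d] of its mean. *)
Lemma iter_gk_op_near M F f (c B : R) n x : gauss_primitive F f ->
  (1 < M)%N -> 0 <= B -> 0 <= c ->
  (forall x, 0 <= x <= 1 -> `|f x| <= B) -> lip01 c f -> 0 <= x <= 1 ->
  `|iter n (gk_op M) f x - (F 1 - F 0) / ln 2| <=
  (7/8) ^+ n * c + n%:R * (6 * B / M.+1%:R).
Proof.
move=> Ff M1 B0 c0 fB fc x01.
have [G Gf GF] := iter_gk_op_span M n Ff B0 fB.
set h := iter n (gk_op M) f in Gf *.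
pose d := (7/8) ^+ n * c + n%:R * (4 * B / M.+1%:R).
have osc y : 0 <= y <= 1 -> `|h y - h x| <= d.
  move=> y01.
  have := iter_gk_op_full_lip n M1 c0 fc x01 y01.
  have := iter_gk_op_full_sub n (ltnW M1) B0 fB x01.
  have := iter_gk_op_full_sub n (ltnW M1) B0 fB y01.
  rewrite -/h; set k := iter n (gk_op_full M) f => h1 h2 h3.
  have -> : h y - h x = (k y - k x) - (k y - h y) + (k x - h x) by ring.
  apply: le_trans (ler_normD _ _) _.
  apply: le_trans (lerD (ler_normB _ _) (lexx _)) _.
  have : `|y - x| <= 1 by rewrite ler_norml; lra.
  have : 0 <= (7/8) ^+ n * c by rewrite mulr_ge0 // exprn_ge0 //; lra.
  rewrite /d; set e := (7/8) ^+ n * c in h3 *; set M' := M.+1%:R^-1 in h1 h2 *.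
  move=> e0 yx1.
  have : e * `|y - x| <= e by rewrite ler_piMr.
  lra.
have l2 := ln2_ge_half; have l20 : 0 < ln 2 :> R by lra.
have two : 1 + 1 = 2 :> R by ring.
have up : G 1 - G 0 <= (h x + d) * ln 2.
  have := @gauss_primitive_le G h (h x + d) 0 1 Gf; rewrite addr0 ln1 subr0 two.
  by apply => // y /osc; rewrite ler_norml; lra.
have dn : (h x - d) * ln 2 <= G 1 - G 0.
  have := @gauss_primitive_le _ _ (- (h x - d)) 0 1 (gauss_primitiveN Gf).
  rewrite addr0 ln1 subr0 two => /(_ _ _ _ _); rewrite mulNr => H.
  suff : - G 1 - - G 0 <= - ((h x - d) * ln 2) by lra.
  by apply: H => // y /osc; rewrite ler_norml; lra.
have -> : h x - (F 1 - F 0) / ln 2 =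
   (h x - (G 1 - G 0) / ln 2) + ((G 1 - G 0) - (F 1 - F 0)) / ln 2.
  by field; lra.
apply: le_trans (ler_normD _ _) _.
(* [6 = 4 + 2]: passing between [gk_op_full] and [gk_op] at two points costs twice [2 * B / (M + 1)]
   per step, and the drift of the mean [B / (M + 1)] times [1 / ln 2 <= 2]. *)
have -> : (7/8) ^+ n * c + n%:R * (6 * B / M.+1%:R) =
   d + n%:R * (B / M.+1%:R) * 2 by rewrite /d; ring.
apply: lerD.
  rewrite ler_norml.
  have -> : h x - (G 1 - G 0) / ln 2 = (h x * ln 2 - (G 1 - G 0)) / ln 2 by field; lra.
  by rewrite ler_pdivlMr // ler_pdivrMr //; apply/andP; split; lra.
rewrite normrM; apply: ler_pM => //.
rewrite ger0_norm ?invr_ge0; last exact: ltW.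
by rewrite -[leRHS]invrK lef_pV2 ?posrE //; lra.
Qed.

Lemma iter_gk_op_cvg F f (c B : R) : gauss_primitive F f -> 0 <= B -> 0 <= c ->
  (forall x, 0 <= x <= 1 -> `|f x| <= B) -> lip01 c f ->
  forall e : R, 0 < e -> exists n M0, forall M, (M0 <= M)%N ->
  forall x, 0 <= x <= 1 ->
  `|iter n (gk_op M) f x - (F 1 - F 0) / ln 2| <= e.
Proof.
move=> Ff B0 c0 fB fc e e0.
have c1 : 0 < c + 1 by lra.
have [n hn] : exists n, (7/8) ^+ n <= e / 2 / (c + 1).
  have : (fun n => (7/8 : R) ^+ n) @ \oo --> (0 : R).
    by apply: cvg_expr; rewrite ger0_norm; lra.
  move=> /cvgrPdist_le /(_ (e / 2 / (c + 1))).
  rewrite divr_gt0 // ?divr_gt0 // => /(_ isT) [n _ /(_ n (leqnn n))].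
  have h78 : 0 <= 7/8 :> R by lra.
  by rewrite sub0r normrN ger0_norm ?exprn_ge0 //; exists n.
pose K := n%:R * (6 * B); have K0 : 0 <= K by rewrite mulr_ge0 // mulr_ge0.
exists n, (maxn 2 (Num.trunc (K / (e / 2))).+1) => M.
rewrite geq_max => /andP[M1 hM] x x01.
apply: le_trans (iter_gk_op_near _ Ff M1 B0 c0 fB fc x01) _.
have -> : e = e / 2 + e / 2 by field.
apply: lerD.
  apply: (@le_trans _ _ ((e / 2 / (c + 1)) * (c + 1))).
    by apply: ler_pM => //; rewrite ?exprn_ge0 //; lra.
  by rewrite divfK //; lra.
rewrite mulrA -/K ler_pdivrMr ?ltr0n // mulrC -ler_pdivrMr ?divr_gt0 //.
apply: (@le_trans _ _ M%:R); last by rewrite ler_nat.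
apply: le_trans (ltW (truncnS_gt _)) _; rewrite ler_nat //.
Qed.

(** * The weight of a fixed string *)

Lemma word_weight_rcons s a x :
  word_weight (rcons s a) x = digit_weight a x * word_weight s (a%:R + x)^-1.
Proof. by rewrite -cats1 word_weight_cat /= mulr1 mulrC. Qed.

Lemma cf_eval_rcons s a x : cf_eval (rcons s a) x = cf_eval s (a%:R + x)^-1.
Proof. by rewrite -cats1 cf_eval_cat. Qed.

Lemma word_weight_le1 s x : all (fun d => 0 < d)%N s -> 0 <= x <= 1 ->
  word_weight s x <= 1.
Proof.
elim: s => //= a s IH /andP[a0 s0] x01; have e01 := cf_eval_itv s0 x01.
rewrite mulr_ile1 ?IH ?word_weight_ge0 ?digit_weight_le1 //.
by apply: digit_weight_ge0; case/andP: e01.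
Qed.

(** Iterated change of variables: the Gauss integral of [word_weight s] over an interval is the
    Gauss measure, up to the factor [ln 2], of its image under [cf_eval s]. The sign records that
    every branch reverses orientation. *)
Lemma gauss_primitive_word_weight s : all (fun d => 0 < d)%N s ->
  gauss_primitive (fun x => (-1) ^+ size s * ln (1 + cf_eval s x)) (word_weight s).
Proof.
elim/last_ind: s => [_ x x0|s a IH].
  rewrite /= mul1r (_ : (fun y => _) = (fun y : R => ln (1 + y))).
    by apply: is_derive_ln1D; lra.
  by apply/funext => y /=; rewrite mul1r.
rewrite all_rcons => /andP[a0 s0].
have := gauss_primitive_digit a0 (IH s0).
rewrite (_ : word_weight (rcons s a) =
   fun x => digit_weight a x * word_weight s (a%:R + x)^-1); last first.
  by apply/funext => x; rewrite word_weight_rcons.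
rewrite (_ : (fun x => _ * ln (1 + cf_eval (rcons s a) x)) =
  fun x => - ((-1) ^+ size s * ln (1 + cf_eval s (a%:R + x)^-1))) //.
by apply/funext => x; rewrite size_rcons exprS mulN1r mulNr cf_eval_rcons.
Qed.

Lemma digit_tail_lip m : (0 < m)%N -> lip01 1 (digit_tail m).
Proof.
move=> /natr_ge1 m1 x y /andP[x0 x1] /andP[y0 y1]; rewrite mul1r /digit_tail.
have -> : (1 + y) / (m%:R + y) - (1 + x) / (m%:R + x) =
   (y - x) * ((m%:R - 1) / ((m%:R + x) * (m%:R + y))).
  by field; apply/andP; split; lra.
rewrite normrM ler_piMr // ger0_norm; last first.
  by rewrite divr_ge0 ?mulr_ge0 //; lra.
rewrite ler_pdivrMr; last by rewrite mulr_gt0 //; lra.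
nra.
Qed.

Lemma word_weight_lip s : all (fun d => 0 < d)%N s ->
  exists2 c : R, 0 <= c & lip01 c (word_weight s).
Proof.
elim/last_ind: s => [_|s a IH].
  by exists 0 => // x y _ _ /=; rewrite subrr normr0 mul0r.
rewrite all_rcons => /andP[a0 s0]; have [c c0 sc] := IH s0.
exists (2 + c); first by lra.
move=> x y x01 y01; rewrite !word_weight_rcons.
have /andP[x0 x1] := x01; have /andP[y0 y1] := y01; have a1 := natr_ge1 a0.
set u := (a%:R + x)^-1; set v := (a%:R + y)^-1.
have u01 : 0 <= u <= 1 by apply: inv_digit_itv.
have v01 : 0 <= v <= 1 by apply: inv_digit_itv.
have -> : digit_weight a y * word_weight s v - digit_weight a x * word_weight s u =
  (digit_weight a y - digit_weight a x) * word_weight s v +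
  digit_weight a x * (word_weight s v - word_weight s u) by ring.
apply: le_trans (ler_normD _ _) _; rewrite [leRHS]mulrDl; apply: lerD.
  rewrite normrM; apply: (@le_trans _ _ `|digit_weight a y - digit_weight a x|).
    rewrite ler_piMr // ger0_norm ?word_weight_le1 ?word_weight_ge0 //.
  rewrite !digit_weightE //.
  have := digit_tail_lip a0 x01 y01; have := @digit_tail_lip a.+1 isT _ _ x01 y01.
  rewrite !mul1r => h1 h2.
  have -> : digit_tail a y - digit_tail a.+1 y - (digit_tail a x - digit_tail a.+1 x) =
   (digit_tail a y - digit_tail a x) - (digit_tail a.+1 y - digit_tail a.+1 x) by ring.
  apply: le_trans (ler_normB _ _) _; lra.
rewrite normrM; apply: (@le_trans _ _ `|word_weight s v - word_weight s u|).
  by rewrite ler_piMl // ger0_norm ?digit_weight_le1 ?digit_weight_ge0.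
apply: le_trans (sc _ _ u01 v01) _; rewrite ler_wpM2l //.
rewrite (_ : v - u = - (y - x) * ((a%:R + x) * (a%:R + y))^-1); last first.
  by rewrite /u /v; field; apply/andP; split; lra.
rewrite normrM normrN ler_piMr // ger0_norm; last first.
  by rewrite invr_ge0 mulr_ge0 //; lra.
rewrite invf_le1; [nra | by rewrite mulr_gt0 //; lra].
Qed.

(** The Gauss measure of the interval with ends [cf_eval s 0] and [cf_eval s 1], the sign putting
    the ends in order. *)
Definition gauss_mass s : R :=
  (-1) ^+ size s * (ln (1 + cf_eval s 1) - ln (1 + cf_eval s 0)) / ln 2.

(** The iterate is the probability of drawing [s] right after a gap of [n] digits, which makes the
    chain forget [x]. That [n] and [M0] do not depend on [x] or [M] is what later uses need. *)
Lemma word_weight_equidistributed s : all (fun d => 0 < d)%N s ->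
  forall e : R, 0 < e -> exists n M0, forall M, (M0 <= M)%N ->
  forall x, 0 <= x <= 1 ->
  `|iter n (gk_op M) (word_weight s) x - gauss_mass s| <= e.
Proof.
move=> s0 e e0; have [c c0 sc] := word_weight_lip s0.
have Fs := gauss_primitive_word_weight s0.
have sB x : 0 <= x <= 1 -> `|word_weight s x| <= 1.
  by move=> x01; rewrite ger0_norm ?word_weight_ge0 ?word_weight_le1.
have := iter_gk_op_cvg Fs ler01 c0 sB sc e0.
by rewrite -mulrBr.
Qed.

Lemma gauss_mass_itv s : all (fun d => 0 < d)%N s -> 0 <= gauss_mass s <= 1.
Proof.
move=> s0; have Fs := gauss_primitive_word_weight s0.
have l2 := ln2_ge_half; have l20 : 0 < ln 2 :> R by lra.
have two : 1 + 1 = 2 :> R by ring.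
rewrite /gauss_mass mulrBr ler_pdivrMr // ler_pdivlMr // mul0r.
have := @gauss_primitive_le _ _ 1 0 1 Fs; rewrite addr0 ln1 subr0 two.
move=> -> //; last by move=> x x01; apply: word_weight_le1.
have := @gauss_primitive_le _ _ 0 0 1 (gauss_primitiveN Fs).
rewrite !mul0r => H; rewrite andbT.
rewrite -oppr_le0 opprB addrC -[X in _ + X]opprK; apply: H => // x x01.
by rewrite oppr_le0 word_weight_ge0.
Qed.

End GaussKuzminOperator.

(** * Large deviations *)


Section LargeDeviations.
Variable R : realType.
Implicit Types (x y t : R) (w s : seq nat) (F : seq nat -> R).

Fixpoint words (M L : nat) : seq (seq nat) :=
  if L is L'.+1 then [seq a :: w | a <- index_iota 1 M.+1, w <- words M L']
  else [:: [::]].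

Lemma mem_words M L w :
  (w \in words M L) = (size w == L) && all (fun d => 0 < d <= M)%N w.
Proof.
elim: L w => [|L IH] [|a w] //=.
  by apply/negbTE/allpairsP => -[[b v] /= [_ _]].
rewrite eqSS; apply/allpairsP/idP => [[[b v] /= [+ + [-> ->]]]|].
  by rewrite mem_index_iota IH ltnS => -> /andP[-> ->].
move=> /and3P[sw aM wM]; exists (a, w); split => //=.
  by rewrite mem_index_iota ltnS.
by rewrite IH sw.
Qed.

Lemma words_uniq M L : uniq (words M L).
Proof.
elim: L => //= L IH; apply: allpairs_uniq => //; first exact: iota_uniq.
by move=> [a w] [b v] /= _ _ [-> ->].
Qed.

Lemma words_pos M L w : w \in words M L -> all (fun d => 0 < d)%N w.
Proof.
by rewrite mem_words => /andP[_ /allP h]; apply/allP => d /h /andP[].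
Qed.

Lemma words_size M L w : w \in words M L -> size w = L.
Proof. by rewrite mem_words => /andP[/eqP]. Qed.

Lemma sum_words_cat M L1 L2 F :
  \sum_(w <- words M (L1 + L2)) F w =
  \sum_(w1 <- words M L1) \sum_(w2 <- words M L2) F (w1 ++ w2).
Proof.
elim: L1 F => [|L1 IH] F; first by rewrite add0n big_seq1.
rewrite addSn /= !big_allpairs_dep /=.
by apply: eq_bigr => a _; rewrite (IH (fun w => F (a :: w))).
Qed.

(** Expectation of [F] over [L] digits drawn backwards from [x]; the total mass is at most 1, since
    draws above [M] are lost. *)
Definition wexp M L F x : R := \sum_(w <- words M L) word_weight w x * F w.

Lemma wexp_gk_op M n (f : R -> R) x :
  \sum_(w <- words M n) word_weight w x * f (cf_eval w x) = iter n (gk_op M) f x.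
Proof.
elim: n f => [|n IH] f; first by rewrite big_seq1 /= mul1r.
rewrite iterSr -IH /= big_allpairs_dep /= exchange_big /=.
apply: eq_bigr => w _; rewrite /gk_op big_distrr /=.
by apply: eq_bigr => a _; ring.
Qed.

Lemma wexp1_le M L x : 0 <= x <= 1 -> wexp M L (fun=> 1) x <= 1.
Proof.
move=> x01; rewrite /wexp (wexp_gk_op M L (fun=> 1)).
have := @iter_gk_op_norm_le R M (fun=> 1) 1 L ler01.
move=> /(_ (fun _ _ => _)) H; apply: le_trans (ler_norm _) _.
by apply: H => // *; rewrite normr1.
Qed.

(** The right part [w2] is drawn first, from [x], then [w1] from the tail [cf_eval w2 x].
    Independence is replaced by the uniformity of [A1] in the tail. *)
Lemma wexp_cat_le M L1 L2 F F1 F2 (A1 A2 : R) x : 0 <= x <= 1 ->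
  (forall w1 w2, w1 \in words M L1 -> w2 \in words M L2 ->
     F (w1 ++ w2) <= F1 w1 * F2 w2) ->
  (forall w, 0 <= F2 w) -> 0 <= A1 ->
  (forall y, 0 <= y <= 1 -> wexp M L1 F1 y <= A1) -> wexp M L2 F2 x <= A2 ->
  wexp M (L1 + L2) F x <= A1 * A2.
Proof.
move=> x01 FF F20 A10 h1 h2; rewrite /wexp sum_words_cat exchange_big /=.
apply: le_trans (ler_wpM2l A10 h2); rewrite /wexp big_distrr /=.
rewrite big_seq [leRHS]big_seq; apply: ler_sum => w2 w2M.
have p2 := words_pos w2M.
rewrite mulrCA [A1 * _]mulrC.
apply: (@le_trans _ _ (word_weight w2 x * (F2 w2 * wexp M L1 F1 (cf_eval w2 x)))).
  rewrite /wexp !big_distrr /= big_seq [leRHS]big_seq.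
  apply: ler_sum => w1 w1M; rewrite word_weight_cat.
  have := FF _ _ w1M w2M.
  have := word_weight_ge0 p2 x01.
  have := word_weight_ge0 (words_pos w1M) (cf_eval_itv p2 x01).
  set u := word_weight _ _; set v := word_weight _ _ => u0 v0 h.
  rewrite (_ : v * _ = (u * v) * (F1 w1 * F2 w2)); last by ring.
  by rewrite ler_wpM2l // mulr_ge0.
rewrite ler_wpM2l ?word_weight_ge0 // ler_wpM2l // h1 //.
exact: cf_eval_itv.
Qed.

(** * The Chernoff bound *)

Lemma expR_le_quadratic t : `|t| <= 2^-1 -> expR t <= 1 + t + 2 * t ^+ 2.
Proof.
rewrite ler_norml => /andP[t1 t2].
have t3 : 0 < 1 - t by lra.
have h : 1 - t <= expR (- t) by apply: expR_ge1Dx.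
rewrite -[t in expR t]opprK expRN.
apply: (@le_trans _ _ (1 - t)^-1).
  by rewrite lef_pV2 ?posrE // (lt_le_trans t3 h).
rewrite -[leLHS]mul1r ler_pdivrMr //; nra.
Qed.

Lemma expR_sub1_norm_le t : `|t| <= 2^-1 -> `|expR t - 1| <= 2 * `|t|.
Proof.
move=> t1; have := expR_le_quadratic t1; have := expR_ge1Dx t.
move: t1; rewrite !ler_norml => /andP[t1 t2] h1 h2.
have [t0|t0] := leP 0 t.
  by rewrite ger0_norm //; apply/andP; split; nra.
by rewrite ltr0_norm //; apply/andP; split; nra.
Qed.

Definition centered s (m : R) w : R := (prefix s w)%:R - m.

(** Start positions too close to the end of [w] count as misses; [deviation_hit] absorbs this. *)
Definition deviation s m w : R := \sum_(0 <= i < size w) centered s m (drop i w).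

(** The last [n] digits of the block are drawn first and act as the gap, so the window in front of
    them equals [s] with probability within [e] of [m], whatever [x] is. Centering cancels the term
    linear in [t] up to [2 * |t| * e]. *)
Lemma wexp_block_le M n s (m e t x : R) :
  all (fun d => 0 < d <= M)%N s -> 0 <= m <= 1 -> 0 <= e -> `|t| <= 2^-1 ->
  (forall y, 0 <= y <= 1 -> `|iter n (gk_op M) (word_weight s) y - m| <= e) ->
  0 <= x <= 1 ->
  wexp M (size s + n) (fun w => expR (t * centered s m w)) x <=
  expR (2 * t ^+ 2 + 2 * `|t| * e).
Proof.
move=> sM /andP[m0 m1] e0 t1 hs x01.
have sw : s \in words M (size s) by rewrite mem_words eqxx.
have body y : 0 <= y <= 1 ->
    \sum_(w1 <- words M (size s)) word_weight w1 y * (1 + (expR t - 1) * (s == w1)%:R)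
    <= 1 + (expR t - 1) * word_weight s y.
  move=> y01; under eq_bigr => w1 _ do rewrite mulrDr mulrCA.
  have hs1 : \sum_(w1 <- words M (size s)) word_weight w1 y * (s == w1)%:R =
      word_weight s y.
    rewrite (bigD1_seq s) ?words_uniq //= eqxx mulr1 big1 ?addr0 // => w.
    by rewrite eq_sym => /negbTE ->; rewrite mulr0.
  by rewrite big_split /= -big_distrr /= hs1 lerD2r; apply: wexp1_le.
apply: (@le_trans _ _ (expR (- (t * m)) *
    \sum_(w2 <- words M n) word_weight w2 x *
      (1 + (expR t - 1) * word_weight s (cf_eval w2 x)))).
  rewrite /wexp sum_words_cat exchange_big /= big_distrr /=.
  rewrite big_seq [leRHS]big_seq; apply: ler_sum => w2 w2M.
  have p2 := words_pos w2M.
  have := body _ (cf_eval_itv p2 x01).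
  move=> /(ler_wpM2l (word_weight_ge0 p2 x01)) /(ler_wpM2l (expR_ge0 (- (t * m)))).
  apply: le_trans; rewrite !big_distrr /= big_seq [leRHS]big_seq.
  apply: ler_sum => w1 w1M; rewrite word_weight_cat.
  have -> : expR (t * centered s m (w1 ++ w2)) =
      expR (- (t * m)) * (1 + (expR t - 1) * (s == w1)%:R).
    rewrite /centered prefixE -(words_size w1M) take_size_cat // eq_sym.
    rewrite mulrBr expRD mulrC; congr (_ * _).
    by case: eqP => _; rewrite ?mulr1 ?mulr0 ?expR0; ring.
  by rewrite le_eqVlt; apply/orP; left; apply/eqP; ring.
have -> : \sum_(w2 <- words M n) word_weight w2 x *
      (1 + (expR t - 1) * word_weight s (cf_eval w2 x)) =
   wexp M n (fun=> 1) x + (expR t - 1) * iter n (gk_op M) (word_weight s) x.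
  rewrite -wexp_gk_op /wexp big_distrr /= -big_split /=.
  by apply: eq_bigr => w _; ring.
set P := iter _ _ _ _; have := hs x x01; rewrite -/P => hP.
have h1 := wexp1_le M n x01.
have h2 : (expR t - 1) * P <= (expR t - 1) * m + 2 * `|t| * e.
  rewrite -lerBlDl -mulrBr; apply: le_trans (ler_norm _) _; rewrite normrM.
  by apply: ler_pM => //; apply: expR_sub1_norm_le.
have h3 : (expR t - 1) * m <= t * m + 2 * t ^+ 2.
  have := expR_le_quadratic t1 => h.
  apply: (@le_trans _ _ ((t + 2 * t ^+ 2) * m)).
    by rewrite ler_wpM2r //; lra.
  by rewrite mulrDl lerD2l ler_piMr // mulr_ge0 // sqr_ge0.
rewrite expRN ler_pdivrMl ?expR_gt0 // -expRD.
apply: le_trans (expR_ge1Dx _); lra.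
Qed.

Lemma centered_cat s m w1 w2 : (size s <= size w1)%N ->
  centered s m (w1 ++ w2) = centered s m w1.
Proof. by move=> sw; rewrite /centered !prefixE takel_cat. Qed.

(** As [size s <= b], each summand reads its own block only, and the blocks peel off one at a time
    by [wexp_cat_le]. *)
Lemma wexp_blocks_le M s b (m q t : R) :
  (size s <= b)%N -> (forall x, 0 <= x <= 1 ->
    wexp M b (fun w => expR (t * centered s m w)) x <= expR q) ->
  forall J L, (J * b <= L)%N -> forall x, 0 <= x <= 1 ->
  wexp M L (fun w => expR (t * \sum_(0 <= j < J) centered s m (drop (j * b) w))) x
  <= expR (J%:R * q).
Proof.
move=> sb hb; elim=> [|J IH] L JL x x01.
  rewrite mul0r expR0; apply: le_trans (wexp1_le M L x01).
  rewrite /wexp; apply: ler_sum => w _.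
  by rewrite big_geq // mulr0 expR0.
have bL : (b <= L)%N by apply: leq_trans JL; rewrite mulSn leq_addr.
rewrite -(subnKC bL) -natr1 mulrDl mul1r addrC expRD.
apply: (wexp_cat_le (F1 := fun w => expR (t * centered s m w))
  (F2 := fun w => expR (t * \sum_(0 <= j < J) centered s m (drop (j * b) w)))) => //.
- move=> w1 w2 w1M w2M; rewrite big_nat_recl // mul0n drop0.
  rewrite centered_cat ?(words_size w1M) // mulrDr expRD.
  under eq_bigr => j _ do
    rewrite mulSn addnC -drop_drop -{2}(words_size w1M) drop_size_cat //.
  exact: lexx.
- by apply: IH => //; rewrite leq_subRL // -mulSn.
Qed.

Lemma wexp_blocks_offset_le M s b (m q t : R) :
  (size s <= b)%N -> (forall x, 0 <= x <= 1 ->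
    wexp M b (fun w => expR (t * centered s m w)) x <= expR q) ->
  forall J r L, (r + J * b <= L)%N -> forall x, 0 <= x <= 1 ->
  wexp M L (fun w => expR (t * \sum_(0 <= j < J) centered s m (drop (r + j * b) w))) x
  <= expR (J%:R * q).
Proof.
move=> sb hb J r L rL x x01.
have r1 : (r <= L)%N by apply: leq_trans rL; rewrite leq_addr.
rewrite -(subnKC r1) -[expR (J%:R * q)]mul1r.
apply: (wexp_cat_le (F1 := fun=> 1)
  (F2 := fun w => expR (t * \sum_(0 <= j < J) centered s m (drop (j * b) w)))) => //.
- move=> w1 w2 w1M w2M; rewrite mul1r.
  have dr j : drop (r + j * b) (w1 ++ w2) = drop (j * b) w2.
    by rewrite addnC -drop_drop drop_size_cat // (words_size w1M).
  under eq_bigr => j _ do rewrite dr.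
  exact: lexx.
- by move=> y y01; apply: wexp1_le.
- by apply: (wexp_blocks_le sb hb) => //; rewrite leq_subRL.
Qed.

Lemma sum_nat_blocks (V : zmodType) (c : nat -> V) b J :
  \sum_(0 <= i < J * b) c i = \sum_(0 <= r < b) \sum_(0 <= j < J) c (r + j * b)%N.
Proof.
rewrite exchange_big_nat /=; elim: J => [|J IH]; first by rewrite mul0n !big_geq.
rewrite big_nat_recr //= -IH mulSn addnC (big_cat_nat _ (leq_addr b (J * b))) //=.
congr (_ + _); rewrite -{1}[(J * b)%N]add0n big_addn addKn.
by apply: eq_bigr.
Qed.

Lemma exists_ge_avg b (Y : nat -> R) (z : R) : (0 < b)%N ->
  b%:R * z <= \sum_(0 <= r < b) Y r -> exists2 r, (r < b)%N & z <= Y r.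
Proof.
move=> b0 h; apply: contrapT => H.
suff : \sum_(0 <= r < b) Y r < b%:R * z by rewrite ltNge h.
rewrite mulr_natl -[b in z *+ b]subn0 -sumr_const_nat.
apply: ltr_sum_nat => // r /andP[_ rb]; rewrite ltNge; apply/negP => zr.
by apply: H; exists r.
Qed.

Lemma centered_norm_le s (m : R) w : 0 <= m <= 1 -> `|centered s m w| <= 1.
Proof.
by move=> /andP[m0 m1]; rewrite /centered ler_norml; case: prefix => /=; lra.
Qed.

Lemma sum_centered_norm_le s (m : R) w a b : 0 <= m <= 1 ->
  `|\sum_(a <= i < b) centered s m (drop i w)| <= (b - a)%:R.
Proof.
move=> m01; apply: le_trans (ler_norm_sum _ _ _) _.
rewrite -[leRHS]mulr1 mulr_natl -sumr_const_nat.
by apply: ler_sum => i _; apply: centered_norm_le.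
Qed.

(** A large total forces a large sum along one of the [b] progressions of step [b]; Markov's
    inequality for the exponential and a union over the offsets conclude. Both signs of [t] are
    allowed, which covers both tails. *)
Lemma deviation_tail_le M L s b (m q t e x : R) :
  (0 < b)%N -> (size s <= b)%N -> 0 <= m <= 1 -> 0 <= x <= 1 -> (b <= L)%N ->
  (forall x, 0 <= x <= 1 ->
    wexp M b (fun w => expR (t * centered s m w)) x <= expR q) ->
  0 <= q -> `|t| <= 2^-1 ->
  \sum_(w <- words M L | `|t| * e * L%:R <= t * deviation s m w) word_weight w x
  <= b%:R * expR (1 + L%:R / b%:R * (q - `|t| * e)).
Proof.
move=> b0 sb m01 x01 bL hb q0 t1.
have b0' : 0 < b%:R :> R by rewrite ltr0n.
(* One block fewer than fits, so that the blocks still fit after a shift by any [r < b]; at most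
   [2 * b] positions remain. *)
pose J := (L %/ b).-1.
have JL : (J.+1 * b <= L)%N by rewrite /J prednK ?divn_gt0 // leq_trunc_div.
have LJ : (L < J.+2 * b)%N by rewrite /J prednK ?divn_gt0 // -ltn_divLR.
pose Y r w := \sum_(0 <= j < J) centered s m (drop (r + j * b) w).
(* The [- 1] pays for the remaining positions: at most [2 * b] terms bounded by 1, times
   [|t| <= 1/2], averaged over [b] offsets. *)
pose z := `|t| * e * L%:R / b%:R - 1.
apply: (@le_trans _ _ (\sum_(w <- words M L) word_weight w x *
    (expR (- z) * \sum_(0 <= r < b) expR (t * Y r w)))).
  rewrite [leRHS](bigID (fun w => `|t| * e * L%:R <= t * deviation s m w)) /=.
  rewrite -[leLHS]addr0; apply: lerD; last first.
    rewrite big_seq_cond; apply: sumr_ge0 => w /andP[ww _].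
    rewrite mulr_ge0 ?word_weight_ge0 ?(words_pos ww) // mulr_ge0 ?expR_ge0 //.
    by apply: sumr_ge0 => r _; apply: expR_ge0.
  rewrite big_seq_cond [leRHS]big_seq_cond; apply: ler_sum => w /andP[ww wD].
  rewrite -[leLHS]mulr1 ler_wpM2l ?word_weight_ge0 ?(words_pos ww) //.
  have [r rb zr] : exists2 r, (r < b)%N & z <= t * Y r w.
    apply: exists_ge_avg => //; rewrite -big_distrr /=.
    rewrite -(sum_nat_blocks (fun i => centered s m (drop i w))).
    have JbL : (J * b <= L)%N by apply: leq_trans JL; rewrite leq_mul2r leqnSn orbT.
    move: wD; rewrite /deviation (words_size ww) (big_cat_nat _ JbL) //= mulrDr.
    set S1 := \sum_(_ <= _ < J * b) _.
    have := sum_centered_norm_le s w (J * b) L m01; set S2 := \sum_(_ <= _ < L) _.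
    move=> hS2.
    have h2 : `|S2| <= 2 * b%:R.
      apply: le_trans hS2 _; rewrite -natrM ler_nat.
      by rewrite leq_subLR -mulnDl addn2 ltnW.
    have h3 : t * S2 <= b%:R.
      apply: le_trans (ler_norm _) _; rewrite normrM.
      have -> : b%:R = 2^-1 * (2 * b%:R) :> R by field.
      exact: ler_pM.
    have -> : b%:R * z = `|t| * e * L%:R - b%:R.
      by rewrite /z; field; rewrite gt_eqF.
    lra.
  rewrite expRN ler_pdivlMl ?expR_gt0 // mulr1.
  apply: (@le_trans _ _ (expR (t * Y r w))); first by rewrite ler_expR.
  rewrite big_mkord (bigD1 (Ordinal rb)) //= lerDl.
  by apply: sumr_ge0 => i _; apply: expR_ge0.
have -> : \sum_(w <- words M L) word_weight w x *
    (expR (- z) * \sum_(0 <= r < b) expR (t * Y r w)) =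
   expR (- z) * \sum_(0 <= r < b) wexp M L (fun w => expR (t * Y r w)) x.
  rewrite exchange_big /= big_distrr /=; apply: eq_bigr => w _.
  by rewrite !big_distrr /=; apply: eq_bigr => r _; ring.
apply: (@le_trans _ _ (expR (- z) * \sum_(0 <= r < b) expR (J%:R * q))).
  rewrite ler_wpM2l ?expR_ge0 //; apply: ler_sum_nat => r /andP[_ rb].
  apply: (wexp_blocks_offset_le sb hb) => //.
  by apply: leq_trans JL; rewrite mulSn leq_add2r ltnW.
rewrite sumr_const_nat subn0 -[_ *+ b]mulr_natl mulrCA -expRD ler_wpM2l ?ler0n // ler_expR.
have : J%:R * q <= L%:R / b%:R * q.
  rewrite ler_wpM2r // ler_pdivlMr // -natrM ler_nat.
  by apply: leq_trans JL; rewrite leq_mul2r leqnSn orbT.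
rewrite /z => h.
have -> : L%:R / b%:R * (q - `|t| * e) =
  L%:R / b%:R * q - `|t| * e * L%:R / b%:R by ring.
lra.
Qed.

Lemma deviation_large_le s (e : R) : (0 < size s)%N ->
  all (fun d => 0 < d)%N s -> 0 < e <= 1 ->
  exists C k : R, [/\ 0 < C, 0 < k & exists M0, forall M L x,
   (M0 <= M)%N -> 0 <= x <= 1 ->
   \sum_(w <- words M L | e * L%:R <= `|deviation s (gauss_mass R s) w|)
     word_weight w x <= C * expR (- (k * L%:R))].
Proof.
move=> s1 s0 /andP[e0 e1]; set m := gauss_mass R s.
have m01 : 0 <= m <= 1 by apply: gauss_mass_itv.
have e80 : 0 < e / 8 by lra.
have [n [M0 hM]] := word_weight_equidistributed s0 e80.
(* With [t = e / 8] and window accuracy [e / 8], a block costs [q = e ^ 2 / 16] and gains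
   [t * e = e ^ 2 / 8]; the surplus per digit is [k]. *)
pose b := (size s + n)%N; pose t := e / 8; pose k := e ^+ 2 / 16 / b%:R.
have b0 : (0 < b)%N by rewrite addn_gt0 s1.
have b0' : 0 < b%:R :> R by rewrite ltr0n.
have k0 : 0 < k by rewrite /k !divr_gt0 // exprn_gt0.
exists (2 * b%:R * expR 1), k; split => //.
  by rewrite !mulr_gt0 // expR_gt0.
exists (maxn M0 (\max_(d <- s) d)) => M L x.
rewrite geq_max => /andP[MM sM] x01.
have sM' : all (fun d => 0 < d <= M)%N s.
  apply/allP => d ds; rewrite (allP s0) //=.
  by apply: leq_trans sM; apply: leq_bigmax_seq.
(* Below one block [k * L <= 1], so the claimed bound is at least 1 and the total mass suffices. *)
have [Lb|bL] := ltnP L b.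
  apply: (@le_trans _ _ 1).
    apply: le_trans (wexp1_le M L x01).
    rewrite /wexp [leRHS](bigID (fun w => e * L%:R <= `|deviation s m w|)) /=.
    under [X in _ <= X + _]eq_bigr => w _ do rewrite mulr1.
    rewrite lerDl big_seq_cond; apply: sumr_ge0 => w /andP[ww _].
    by rewrite mulr1 word_weight_ge0 // (words_pos ww).
  rewrite -mulrA -expRD.
  have h : 0 <= 1 + - (k * L%:R).
    have : k * L%:R <= k * b%:R.
      by apply: ler_wpM2l; [exact: ltW | rewrite ler_nat; exact: ltnW].
    rewrite /k divfK ?gt_eqF // => h.
    suff : e ^+ 2 <= 1 by lra.
    by rewrite expr_le1 // ltW.
  have : 1 <= expR (1 + - (k * L%:R)) by rewrite -[leLHS]expR0 ler_expR.
  have : 1 <= b%:R :> R by rewrite ler1n.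
  nra.
have t1 : `|t| = e / 8 by rewrite ger0_norm // /t; lra.
pose q := 2 * t ^+ 2 + 2 * `|t| * (e / 8).
have q0 : 0 <= q by rewrite /q t1 /t; nra.
have one (u : R) : `|u| = `|t| ->
   \sum_(w <- words M L | `|u| * e * L%:R <= u * deviation s m w) word_weight w x
   <= b%:R * (expR 1 * expR (- (k * L%:R))).
  move=> ut; have u2 : u ^+ 2 = t ^+ 2.
    by rewrite -[u ^+ 2]real_normK ?num_real // ut real_normK ?num_real.
  have u1 : `|u| <= 2^-1 by rewrite ut t1; lra.
  rewrite -expRD.
  have -> : - (k * L%:R) = L%:R / b%:R * (q - `|u| * e).
    by rewrite ut /q t1 /k /t; field; rewrite gt_eqF.
  apply: deviation_tail_le => //; first by rewrite leq_addr.
  move=> y y01; rewrite /q -u2 -ut.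
  by apply: wexp_block_le => //; [lra | exact: hM].
have -> : 2 * b%:R * expR 1 * expR (- (k * L%:R)) =
   b%:R * (expR 1 * expR (- (k * L%:R))) + b%:R * (expR 1 * expR (- (k * L%:R))) by ring.
apply: le_trans (lerD (one t _) (one (- t) _)); rewrite ?normrN //.
rewrite !(big_mkcond (fun w => _ <= _)) /= -big_split /=.
rewrite big_seq [leRHS]big_seq; apply: ler_sum => w ww.
have W0 := word_weight_ge0 (words_pos ww) x01.
case: ifP => h; last by case: ifP; case: ifP; rewrite ?addr0 ?add0r ?addr_ge0.
have [D0|D0] := leP 0 (deviation s m w).
  rewrite ifT; first by rewrite lerDl; case: ifP.
  rewrite t1 -mulrA /t ler_wpM2l; [by [] | lra | by rewrite (ger0_norm D0) in h].
rewrite [X in _ + X]ifT; first by rewrite lerDr; case: ifP.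
rewrite t1 -mulrA mulNr -mulrN /t ler_wpM2l; [by [] | lra | by rewrite (ltr0_norm D0) in h].
Qed.

End LargeDeviations.

(** * Words of rationals *)


Section RationalWords.
Variable R : realType.
Implicit Types (x y : R) (w s : seq nat).

Lemma cf_tails_cons a w x : cf_tails (a :: w) x = cf_eval (a :: w) x * cf_tails w x.
Proof. by rewrite /cf_tails /= big_ord_recl. Qed.

Lemma cf_tails_nil x : cf_tails [::] x = 1.
Proof. by rewrite /cf_tails big_ord0. Qed.

Lemma cf_tails_gt0 w x : all (fun d => 0 < d)%N w -> 0 <= x <= 1 -> 0 < cf_tails w x.
Proof.
elim: w => [|a w IH] /=; first by rewrite cf_tails_nil.
move=> /andP[a0 w0] x01; rewrite cf_tails_cons mulr_gt0 ?IH //= invr_gt0.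
have := natr_ge1 R a0; have /andP[] := cf_eval_itv w0 x01; lra.
Qed.

(** With [u = 1 / (a + y)] the weight of [a] is [u ^ 2 * (1 + y) / (1 + u)], so the factors
    [1 + tail] telescope. *)
Lemma word_weightE w x : all (fun d => 0 < d)%N w -> 0 <= x <= 1 ->
  word_weight w x = cf_tails w x ^+ 2 * (1 + x) / (1 + cf_eval w x).
Proof.
move=> + x01; elim: w => [|a w IH] /=.
  by rewrite cf_tails_nil expr1n mul1r divff //; lra.
move=> /andP[a0 w0]; rewrite IH // cf_tails_cons /= /digit_weight.
have := natr_ge1 R a0; have /andP[] := cf_eval_itv w0 x01.
set y := cf_eval w x => y0 y1 a1; field.
by do ?[apply/andP; split]; lra.
Qed.

(** Every tail [1 / (a + y)] is at most [1 / a]. *)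
Lemma prod_digits_le w x : all (fun d => 0 < d)%N w -> 0 <= x <= 1 ->
  (\prod_(d <- w) d)%N%:R <= (cf_tails w x)^-1.
Proof.
move=> + x01; elim: w => [|a w IH] /=.
  by rewrite big_nil cf_tails_nil invr1.
move=> /andP[a0 w0]; rewrite big_cons cf_tails_cons natrM invfM /= invrK.
have := natr_ge1 R a0; have /andP[y0 y1] := cf_eval_itv w0 x01 => a1.
by apply: ler_pM; rewrite ?ler0n ?lerDl ?IH.
Qed.

(* Consecutive tails u, v of an expansion satisfy u * v = v / (a + v) <= 1/2. *)
Lemma cf_tails_le a w x : all (fun d => 0 < d)%N (a :: w) -> 0 <= x <= 1 ->
  cf_tails (a :: w) x ^+ 2 <= cf_eval (a :: w) x * 2^-1 ^+ size w.
Proof.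
move=> + x01; elim: w a => [|b w IH] a.
  move=> p; rewrite cf_tails_cons cf_tails_nil /size expr0 !mulr1.
  have /andP[u0 u1] := cf_eval_itv p x01; rewrite expr2 ler_piMl //.
move=> /andP[a0 bw]; rewrite cf_tails_cons exprMn.
have := IH b bw; have /andP[] := @cf_eval_itv R (b :: w) x bw x01.
have a1 := natr_ge1 R a0.
set v := cf_eval (b :: w) x; set T := cf_tails (b :: w) x => v0 v1 h.
have -> : cf_eval (a :: b :: w) x = (a%:R + v)^-1 by [].
set u := (a%:R + v)^-1; have u0 : 0 < u by rewrite invr_gt0; lra.
have uv : u * v <= 2^-1 by rewrite mulrC ler_pdivrMr; lra.
rewrite [size _]/= [2^-1 ^+ _]exprS; set K := 2^-1 ^+ size w in h *.
have K0 : 0 <= K by rewrite exprn_ge0 // invr_ge0.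
apply: (@le_trans _ _ (u ^+ 2 * (v * K))); first by rewrite ler_wpM2l // exprn_ge0 // ltW.
rewrite (_ : u ^+ 2 * _ = u * ((u * v) * K)); last by ring.
by rewrite ler_wpM2l ?(ltW u0) // ler_wpM2r.
Qed.

(** The longer expansion splits the last Gauss digit in two, which [gauss] does not see;
    [gauss x != 0] keeps away from that digit, and [cf_rat_unit] treats it. *)
Lemma cf_digit_shift x i : gauss x != 0 ->
  cf_digit x i.+2 = cf_digit (gauss x) i.+1.
Proof.
move=> gx; rewrite /cf_digit /gauss_orbit.
by case: i => [|i]; rewrite -?iterS ?iterSr //= gx.
Qed.

Lemma truncn_divn (p q : nat) : (0 < p)%N ->
  Num.truncn (q%:R / p%:R : R) = (q %/ p)%N.
Proof.
move=> p0; apply: truncn_def.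
have p0' : 0 < p%:R :> R by rewrite ltr0n.
rewrite ler_pdivlMr // ltr_pdivrMr // -!natrM ler_nat ltr_nat.
by rewrite leq_trunc_div ltn_ceil.
Qed.

Lemma gauss_ratio (p q : nat) : (0 < p)%N -> (0 < q)%N ->
  gauss (p%:R / q%:R : R) = (q %% p)%N%:R / p%:R.
Proof.
move=> p0 q0; rewrite /gauss.
have p0' : p%:R != 0 :> R by rewrite pnatr_eq0 -lt0n.
have q0' : q%:R != 0 :> R by rewrite pnatr_eq0 -lt0n.
rewrite mulf_eq0 invr_eq0 (negbTE p0') (negbTE q0') /= invf_div truncn_divn //.
by rewrite {1}(divn_eq q p) natrD natrM; field.
Qed.

Lemma pmap_cons_some (T U : Type) (f : T -> option U) i j (l : seq T) :
  f i = Some j -> pmap f (i :: l) = j :: pmap f l.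
Proof. by move=> /= ->. Qed.

Lemma pmap_cons_none (T U : Type) (f : T -> option U) i (l : seq T) :
  f i = None -> pmap f (i :: l) = pmap f l.
Proof. by move=> /= ->. Qed.

Lemma pmap_cf_digit_shift x (l : seq nat) : gauss x != 0 ->
  all (fun i => 0 < i)%N l ->
  pmap (cf_digit x) [seq i.+1 | i <- l] = pmap (cf_digit (gauss x)) l.
Proof.
move=> gx; elim: l => // -[|i] l IH // h.
rewrite map_cons -[LHS]/(oapp (cons^~ _) _ _) -[RHS]/(oapp (cons^~ _) _ _).
by rewrite cf_digit_shift // -!/(pmap _ _) -/map IH.
Qed.

Lemma cf_rat_unit (q n : nat) : (1 < q)%N ->
  pmap (cf_digit (1%:R / q%:R : R)) (iota 1 n.+2) = [:: q.-1; 1%N].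
Proof.
move=> q1; have q0 : (0 < q)%N by apply: ltnW.
have x0 : 1%:R / q%:R != 0 :> R by rewrite mulf_eq0 invr_eq0 !pnatr_eq0 -lt0n q0.
have g0 : gauss (1%:R / q%:R : R) = 0 by rewrite gauss_ratio // modn1 mul0r.
have g1 : gauss (0 : R) = 0 by rewrite /gauss eqxx.
have io i : iter i (@gauss R) 0 = 0 by elim: i => //= i ->.
have c1 : cf_digit (1%:R / q%:R : R) 1 = Some q.-1.
  by rewrite /cf_digit /gauss_orbit /= x0 g0 eqxx invf_div truncn_divn // divn1.
have c2 : cf_digit (1%:R / q%:R : R) 2 = Some 1%N.
  by rewrite /cf_digit /gauss_orbit /= g0 eqxx /= x0.
have c3 i : cf_digit (1%:R / q%:R : R) i.+3 = None.
  by rewrite /cf_digit /gauss_orbit !iterSr g0 g1 io eqxx.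
rewrite -[iota 1 n.+2]/(1 :: 2 :: iota 3 n)%N.
rewrite (pmap_cons_some _ c1) (pmap_cons_some _ c2); congr [:: _, _ & _].
have : all (fun i => 3 <= i)%N (iota 3 n).
  by apply/allP => i; rewrite mem_iota => /andP[].
elim: (iota 3 n) => // -[|[|[|i]]] l IHl // hl.
by rewrite (pmap_cons_none _ (c3 i)) IHl.
Qed.

Lemma cf_rat_step (p q n : nat) : (1 < p < q)%N -> coprime p q ->
  pmap (cf_digit (p%:R / q%:R : R)) (iota 1 n.+1) =
  (q %/ p)%N :: pmap (cf_digit ((q %% p)%N%:R / p%:R : R)) (iota 1 n).
Proof.
move=> /andP[p1 pq] cpq; have p0 : (0 < p)%N by apply: ltnW.
have q0 : (0 < q)%N by apply: leq_trans pq.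
have p0' : p%:R != 0 :> R by rewrite pnatr_eq0 -lt0n.
have x0 : p%:R / q%:R != 0 :> R.
  by rewrite mulf_eq0 invr_eq0 (negbTE p0') pnatr_eq0 -lt0n q0.
have r0 : (0 < q %% p)%N.
  rewrite lt0n; apply: contraL p1 => /eqP r0; rewrite -leqNgt dvdn_leq //.
  by rewrite -(eqP cpq) dvdn_gcd dvdnn /= /dvdn r0.
have gx : gauss (p%:R / q%:R : R) = (q %% p)%N%:R / p%:R by rewrite gauss_ratio.
have gx0 : gauss (p%:R / q%:R : R) != 0.
  by rewrite gx mulf_eq0 invr_eq0 (negbTE p0') orbF pnatr_eq0 -lt0n.
have c1 : cf_digit (p%:R / q%:R : R) 1 = Some (q %/ p)%N.
  by rewrite /cf_digit /gauss_orbit /= x0 (negbTE gx0) invf_div truncn_divn.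
rewrite -[iota 1 n.+1]/(1 :: iota (1 + 1) n)%N (pmap_cons_some _ c1) iotaDl.
rewrite (eq_map (g := S)) // pmap_cf_digit_shift //; first by rewrite gx.
by apply/allP => i; rewrite mem_iota => /andP[].
Qed.

(** The Euclidean algorithm, by strong induction on the numerator: [p / q] passes to [(q %% p) / p].
    Numerators decrease strictly, so reading [n > p] digits suffices, and [pmap] drops the positions
    beyond the end. The tails multiply as [p / q * (1 / p)]. *)
Lemma cf_rat_aux (p q n : nat) : (0 < p < q)%N -> coprime p q -> (p < n)%N ->
  let w := pmap (cf_digit (p%:R / q%:R : R)) (iota 1 n) in
  [/\ all (fun d => 0 < d)%N w, w != [::], cf_eval w 0 = p%:R / q%:R :> R
    & cf_tails w 0 = q%:R^-1 :> R].
Proof.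
elim/ltn_ind: p q n => p IH q n /andP[p0 pq] cpq pn.
have q0 : (0 < q)%N by apply: leq_trans pq.
have p0' : p%:R != 0 :> R by rewrite pnatr_eq0 -lt0n.
have q0' : q%:R != 0 :> R by rewrite pnatr_eq0 -lt0n.
have [p1|p1] := eqVneq p 1%N.
  rewrite p1 in pq pn *; case: n pn => [|[|n]] // _; rewrite cf_rat_unit //.
  case: q q0 pq {cpq} q0' => [|[|q]] // _ _ q0'; split => //=.
    by rewrite addr0 invr1 natr1 mul1r.
  by rewrite !cf_tails_cons cf_tails_nil /= addr0 invr1 natr1 !mulr1.
have p2 : (1 < p)%N by rewrite ltn_neqAle eq_sym p1.
case: n pn => // n pn; rewrite cf_rat_step ?p2 //; set r := (q %% p)%N.
have r0 : (0 < r)%N.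
  rewrite lt0n; apply: contraL p2 => /eqP r0; rewrite -leqNgt dvdn_leq //.
  by rewrite -(eqP cpq) dvdn_gcd dvdnn /= /dvdn -/r r0.
have rp : (r < p)%N by rewrite ltn_pmod.
have crp : coprime r p by rewrite coprime_modl coprime_sym.
have := IH r rp p n; rewrite r0 rp => /(_ isT crp (leq_trans rp pn)).
set w := pmap _ _ => -[w0 _ ew tw].
have eqq : q%:R = (q %/ p)%:R * p%:R + r%:R :> R by rewrite {1}(divn_eq q p) natrD natrM.
have eqq0 : (q %/ p)%:R * p%:R + r%:R != 0 :> R by rewrite -eqq.
split => //.
- by rewrite /= w0 divn_gt0 // ltnW.
- by rewrite /= ew eqq; field; rewrite p0' eqq0.
- by rewrite cf_tails_cons /= ew tw eqq; field; rewrite p0' eqq0.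
Qed.

Lemma cf_rat_spec (p q : nat) : (0 < p < q)%N -> coprime p q ->
  let w := cf_rat R p q in
  [/\ all (fun d => 0 < d)%N w, w != [::], cf_eval w 0 = p%:R / q%:R :> R
    & cf_tails w 0 = q%:R^-1 :> R].
Proof.
move=> pq cpq; apply: cf_rat_aux => //.
by case/andP: pq => p0 pq; lia.
Qed.

Lemma cf_rat_bounds (p q : nat) : (0 < p < q)%N -> coprime p q ->
  let w := cf_rat R p q in
  [/\ w \in words q (size w), (\prod_(d <- w) d <= q)%N,
      2^-1 / q%:R ^+ 2 <= word_weight w 0 :> R
    & (size w)%:R <= 4 * ln q%:R + 1 :> R].
Proof.
move=> pq cpq; have [w0 wn we wt] := cf_rat_spec pq cpq; set w := cf_rat R p q in w0 wn we wt *.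
have q1 : (0 < q)%N by case/andP: pq => _; apply: leq_trans.
have q0 : 0 < q%:R :> R by rewrite ltr0n.
have z01 : 0 <= (0 : R) <= 1 by rewrite lexx ler01.
have prodq : (\prod_(d <- w) d <= q)%N.
  by rewrite -(ler_nat R); apply: le_trans (prod_digits_le w0 z01) _; rewrite wt invrK.
split => //=.
- rewrite mem_words eqxx /=; apply/allP => d dw; rewrite (allP w0) //=.
  apply: leq_trans prodq; rewrite (big_rem d) //= leq_pmulr //.
  rewrite big_seq; elim/big_ind: _ => // [m1 m2 h1 h2|i iw]; first by rewrite muln_gt0 h1.
  by rewrite (allP w0) // (mem_rem iw).
- rewrite word_weightE // wt addr0 mulr1 exprVn mulrC ler_wpM2l ?invr_ge0 ?exprn_ge0 ?(ltW q0) //.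
  by have /andP[e0 e1] := cf_eval_itv w0 z01; rewrite lef_pV2 ?posrE //; lra.
(* By [cf_tails_le], 2 to the length minus one is at most [q ^ 2]; [ln 2 >= 1/2] turns this into the
   factor 4. *)
- case: w w0 wn we wt {prodq} => // a w w0 _ _ wt.
  have := cf_tails_le w0 z01; rewrite wt => h.
  have /andP[e0 e1] := cf_eval_itv w0 z01.
  have {}h : q%:R^-1 ^+ 2 <= 2^-1 ^+ size w :> R.
    by apply: le_trans h _; rewrite ler_piMl // exprn_ge0 // invr_ge0.
  rewrite !exprVn lef_pV2 ?posrE ?exprn_gt0 // in h.
  have : ln (2 ^+ size w) <= ln (q%:R ^+ 2) :> R by rewrite ler_ln ?posrE ?exprn_gt0.
  rewrite !lnXn // -[ln 2 *+ _]mulr_natr -[ln q%:R *+ 2]mulr_natr /= -[(size w).+1%:R]natr1 => hl.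
  have := ln2_ge_half R; have : 0 <= (size w)%:R :> R by rewrite ler0n.
  nra.
Qed.

(** [cf_tails] recovers the denominator and [cf_eval] the numerator. Hence words can be counted in
    place of rationals. *)
Lemma cf_rat_inj (p q p' q' : nat) : (0 < p < q)%N -> coprime p q ->
  (0 < p' < q')%N -> coprime p' q' -> cf_rat R p q = cf_rat R p' q' ->
  (p, q) = (p', q').
Proof.
move=> pq c pq' c'; have [_ _ e t] := cf_rat_spec pq c.
have [_ _ e' t'] := cf_rat_spec pq' c'.
move=> E; rewrite E in e t.
have qq : q = q' by apply/eqP; rewrite -(eqr_nat R); apply/eqP/invr_inj; rewrite -t -t'.
have q0 : q%:R != 0 :> R by rewrite pnatr_eq0 -lt0n; case/andP: pq => _; apply: leq_trans.
have pp : p = p'.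
  apply/eqP; rewrite -(eqr_nat R); apply/eqP; apply: (mulIf (invr_neq0 q0)).
  by rewrite -e e' qq.
by rewrite qq pp.
Qed.

End RationalWords.

(** * Counting bad words *)


Definition rats (k : subseq_kind) (Q : nat) : seq (nat * nat) :=
  [seq (p, q) | q <- iota 2 Q.-1,
                p <- [seq p <- iota 1 q.-1 | coprime p q && selR k p q]].

Definition rat_words (R : realType) (k : subseq_kind) (Q : nat) : seq (seq nat) :=
  [seq cf_rat R pq.1 pq.2 | pq <- rats k Q].

Lemma concat_prefixE (R : realType) k Q :
  concat_prefix R k Q = flatten (rat_words R k Q).
Proof.
rewrite /concat_prefix /rat_words /rats; elim: (iota 2 Q.-1) => //= q l IH.
by rewrite map_cat flatten_cat -IH -map_comp.
Qed.

Lemma mem_rats k Q pq : pq \in rats k Q ->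
  [/\ (0 < pq.1 < pq.2)%N, coprime pq.1 pq.2 & (pq.2 <= Q)%N].
Proof.
move=> /allpairsPdep[q [p [+ + ->]]] /=.
rewrite mem_filter !mem_iota => q2 /andP[/andP[c _] p1].
by split => //; lia.
Qed.

Lemma rats_uniq k Q : uniq (rats k Q).
Proof.
apply: allpairs_uniq_dep; first exact: iota_uniq.
  by move=> q _; apply: filter_uniq; apply: iota_uniq.
by move=> [q p] [q' p'] /= _ _ [-> ->].
Qed.

Lemma rats_recr k Q : rats k Q.+2 = rats k Q.+1 ++
  [seq (p, Q.+2) | p <- [seq p <- iota 1 Q.+1 | coprime p Q.+2 && selR k p Q.+2]].
Proof.
rewrite /rats -[Q.+2.-1]/(Q.+1) (_ : iota 2 Q.+1 = iota 2 Q ++ [:: Q.+2]).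
  by rewrite map_cat flatten_cat /= cats0.
by have := iotaD 2 Q 1; rewrite addn1 => ->.
Qed.

Section Counting.
Variable R : realType.
Implicit Types (x y : R) (w s : seq nat).

Lemma rat_words_uniq k Q : uniq (rat_words R k Q).
Proof.
rewrite map_inj_in_uniq ?rats_uniq // => -[p q] [p' q'] /mem_rats /= [a1 a2 _].
by move=> /mem_rats /= [b1 b2 _]; apply: cf_rat_inj.
Qed.

Lemma mem_rat_words k Q w : w \in rat_words R k Q ->
  [/\ w \in words Q (size w), (0 < size w)%N, (\prod_(d <- w) d <= Q)%N,
      1 <= 2 * Q%:R ^+ 2 * word_weight w 0 :> R
    & (size w)%:R <= 4 * ln Q%:R + 1 :> R].
Proof.
move=> /mapP[[p q] /mem_rats /= [pq cpq qQ] ->].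
have [+ + + +] := cf_rat_bounds R pq cpq; have [_ + _ _] := cf_rat_spec R pq cpq.
set w0 := cf_rat R p q => wn h1 h2 h3 h4.
have q0 : (0 < q)%N by case/andP: pq => _; apply: leq_trans.
have q0' : 0 < q%:R :> R by rewrite ltr0n.
have qQ' : q%:R <= Q%:R :> R by rewrite ler_nat.
split.
- move: h1; rewrite !mem_words => /andP[-> /allP h]; apply/allP => d /h /andP[-> /=].
  by move/leq_trans; apply.
- by rewrite lt0n size_eq0.
- exact: leq_trans qQ.
- move: h3; rewrite ler_pdivrMr ?exprn_gt0 // => h3.
  have : q%:R ^+ 2 <= Q%:R ^+ 2 :> R by rewrite lerXn2r ?nnegrE ?ler0n.
  have : 0 <= word_weight w0 0 :> R.
    by apply: word_weight_ge0; [exact: words_pos h1 | rewrite lexx ler01].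
  nra.
- apply: le_trans h4 _; rewrite lerD2r ler_wpM2l // ler_ln ?posrE //.
  exact: lt_le_trans qQ'.
Qed.

Lemma ler_sum_sub (T : eqType) (s1 s2 : seq T) (F : T -> R) : uniq s1 ->
  {subset s1 <= s2} -> (forall i, i \in s2 -> 0 <= F i) ->
  \sum_(i <- s1) F i <= \sum_(i <- s2) F i.
Proof.
elim: s1 s2 => [|a s1 IH] s2 /=.
  by move=> _ _ F0; rewrite big_nil big_seq; apply: sumr_ge0.
move=> /andP[as1 u1] sub F0; have a2 : a \in s2 by apply: sub; rewrite mem_head.
rewrite big_cons [leRHS](big_rem a) //= lerD2l; apply: IH => // [i i1|i /mem_rem]; last exact: F0.
have i2 : i \in s2 by apply: sub; rewrite inE i1 orbT.
have := perm_to_rem a2 => /perm_mem /(_ i); rewrite i2 inE => /esym/orP[/eqP ia|//].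
by rewrite ia (negbTE as1) in i1.
Qed.

(** The exponent 3/2 exceeds 1, so the sum over digits is bounded, and stays below 2, so the
    resulting power of [Q] is smaller than [Q ^ 2]. *)
Definition rankin (d : nat) : R := (d%:R * Num.sqrt d%:R)^-1.

Lemma rankin_ge0 d : 0 <= rankin d.
Proof. by rewrite invr_ge0 mulr_ge0 ?sqrtr_ge0. Qed.

(** The stronger bound [3 - 2 / sqrt M], suggested by the integral of the power -3/2, is what passes
    through the induction. *)
Lemma sum_rankin_le M : \sum_(1 <= d < M.+1) rankin d <= 3.
Proof.
case: M => [|M]; first by rewrite big_geq.
suff : \sum_(1 <= d < M.+2) rankin d <= 3 - 2 / Num.sqrt M.+1%:R.
  by move/le_trans; apply; rewrite gerBl divr_ge0 ?sqrtr_ge0.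
elim: M => [|M IH].
  by rewrite big_nat1 /rankin sqrtr1; lra.
rewrite big_nat_recr //=; apply: le_trans (lerD IH (lexx _)) _; rewrite /rankin.
set a : R := Num.sqrt M.+1%:R; set b : R := Num.sqrt M.+2%:R.
have a0 : 0 < a by rewrite sqrtr_gt0 ltr0n.
have b0 : 0 < b by rewrite sqrtr_gt0 ltr0n.
have ab : b ^+ 2 = a ^+ 2 + 1 by rewrite !sqr_sqrtr ?ler0n // natr1.
have leab : a <= b by rewrite ler_wsqrtr // ler_nat.
have -> : M.+2%:R = b ^+ 2 :> R by rewrite sqr_sqrtr.
rewrite -lerBrDl.
have -> : 3 - 2 / b - (3 - 2 / a) = 2 * (b - a) / (a * b).
  by field; rewrite !gt_eqF.
rewrite -[leLHS]mul1r ler_pdivlMr ?mulr_gt0 // mulrAC ler_pdivrMr ?mulr_gt0 ?exprn_gt0 //.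
rewrite mul1r.
have h : (b - a) * (b + a) = 1 by rewrite -subr_sqr ab; ring.
have h2 : a <= 2 * (b - a) * b ^+ 2.
  apply: (@le_trans _ _ (b * ((b - a) * (b + a)))); first by rewrite h mulr1.
  rewrite (_ : b * _ = (b - a) * b * (b + a)); last by ring.
  rewrite (_ : 2 * _ * _ = (b - a) * b * (2 * b)); last by ring.
  by rewrite ler_wpM2l ?mulr_ge0 //; lra.
have : 0 <= b by lra.
nra.
Qed.

Lemma sum_words_prod (f : nat -> R) M L :
  \sum_(w <- words M L) \prod_(d <- w) f d = (\sum_(1 <= d < M.+1) f d) ^+ L.
Proof.
elim: L => [|L IH]; first by rewrite big_seq1 big_nil.
rewrite /= big_allpairs_dep /= exprS big_distrl /=; apply: eq_bigr => a _.
by rewrite -IH big_distrr /=; apply: eq_bigr => w _; rewrite big_cons.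
Qed.

Lemma prod_rankin w : \prod_(d <- w) rankin d =
  ((\prod_(d <- w) d)%N%:R * Num.sqrt (\prod_(d <- w) d)%N%:R)^-1.
Proof.
elim: w => [|a w IH]; first by rewrite !big_nil sqrtr1 mulr1 invr1.
rewrite !big_cons IH natrM sqrtrM ?ler0n // /rankin -invfM; congr (_^-1); ring.
Qed.

Definition bad_word s (m e : R) (Q : nat) w : bool :=
  ((size w)%:R <= ln (Q%:R : R) / 8) || (e * (size w)%:R <= `|deviation s m w|).

(** A union over at most [4 * ln Q + 2] lengths. The majorant [F] is at least 1 on every bad
    rational word and is summed over all words with digits at most [Q]. *)
Lemma count_bad_word_le s (e : R) : (0 < size s)%N ->
  all (fun d => 0 < d)%N s -> 0 < e <= 1 ->
  exists C c : R, [/\ 0 < C, 0 < c & exists Q0, forall Q k, (Q0 <= Q)%N ->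
   (count (bad_word s (gauss_mass R s) e Q) (rat_words R k Q))%:R <=
   (4 * ln Q%:R + 2) * (C * Q%:R ^+ 2 * expR (- (c * ln Q%:R)))].
Proof.
move=> s1 s0 e01; have [C [c [C0 c0 [M0 hM]]]] := deviation_large_le s1 s0 e01.
set m := gauss_mass R s in hM *.
(* Short words total at most [Q ^ (3/2) * 3 ^ L <= Q ^ (7/4)], as [3 <= exp 2] and [L <= ln Q / 8];
   longer ones save [Q ^ (c / 8)] because [L > ln Q / 8]. *)
exists (1 + 2 * C), (Num.min (4^-1) (c / 8)); split; first by lra.
  by rewrite lt_min; apply/andP; split; lra.
exists (maxn M0 1) => Q k; rewrite geq_max => /andP[MQ Q1].
set c' := Num.min _ _; set l := ln Q%:R.
have Q0 : 0 < Q%:R :> R by rewrite ltr0n.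
have l0 : 0 <= l by rewrite ln_ge0 // ler1n.
have Ql : Q%:R = expR l by rewrite lnK.
have sQl : Num.sqrt Q%:R = expR (l / 2).
  have -> : Q%:R = expR (l / 2) ^+ 2 by rewrite Ql -expRM_natr; congr expR; field.
  by rewrite sqrtr_sqr ger0_norm ?expR_ge0.
pose N := Num.truncn (4 * l + 1).
pose F w : R := if (size w)%:R <= l / 8 then
    Q%:R * Num.sqrt Q%:R * \prod_(d <- w) rankin d
  else if e * (size w)%:R <= `|deviation s m w| then
    2 * Q%:R ^+ 2 * word_weight w 0 else 0.
have z01 : 0 <= (0 : R) <= 1 by rewrite lexx ler01.
have F0 w L : w \in words Q L -> 0 <= F w.
  move=> wQ; rewrite /F; case: ifP => _.
    rewrite !mulr_ge0 ?sqrtr_ge0 ?ler0n // .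
    by elim/big_ind: _ => // *; [exact: mulr_ge0 | exact: rankin_ge0].
  case: ifP => // _; rewrite mulr_ge0 ?mulr_ge0 ?exprn_ge0 //.
  by apply: word_weight_ge0 => //; apply: words_pos wQ.
have FL L : \sum_(w <- words Q L) F w <= (1 + 2 * C) * Q%:R ^+ 2 * expR (- (c' * l)).
  have [Ll|Ll] := leP L%:R (l / 8).
    apply: (@le_trans _ _ (Q%:R * Num.sqrt Q%:R * 3 ^+ L)).
      have -> : \sum_(w <- words Q L) F w =
          \sum_(w <- words Q L) Q%:R * Num.sqrt Q%:R * \prod_(d <- w) rankin d.
        by apply: eq_big_seq => w wQ; rewrite /F (words_size wQ) Ll.
      rewrite -big_distrr /= sum_words_prod ler_wpM2l ?mulr_ge0 ?sqrtr_ge0 ?ler0n //.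
      rewrite lerXn2r ?nnegrE ?sum_rankin_le // sumr_ge0 // => d _.
      exact: rankin_ge0.
    apply: (@le_trans _ _ (Q%:R ^+ 2 * expR (- (4^-1 * l)))).
      have h3 : 3 ^+ L <= expR (l / 4).
        apply: (@le_trans _ _ (expR 2 ^+ L)).
          rewrite lerXn2r ?nnegrE ?expR_ge0 //.
          by have := expR_ge1Dx (2 : R); lra.
        rewrite -expRM_natr ler_expR; lra.
      apply: (@le_trans _ _ (Q%:R * Num.sqrt Q%:R * expR (l / 4))).
        by rewrite ler_wpM2l // mulr_ge0 ?sqrtr_ge0.
      rewrite sQl Ql expr2 -!expRD ler_expR; lra.
    rewrite -[leRHS]mulrA; apply: (@le_trans _ _ (1 * (Q%:R ^+ 2 * expR (- (c' * l))))).
      rewrite mul1r ler_wpM2l ?exprn_ge0 // ler_expR lerN2 ler_wpM2r //.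
      by rewrite ge_min lexx.
    by rewrite ler_wpM2r ?mulr_ge0 ?exprn_ge0 ?expR_ge0 //; lra.
  apply: (@le_trans _ _ (2 * Q%:R ^+ 2 * (C * expR (- (c * L%:R))))).
    have -> : \sum_(w <- words Q L) F w = 2 * Q%:R ^+ 2 *
       \sum_(w <- words Q L | e * L%:R <= `|deviation s m w|) word_weight w 0.
      rewrite big_distrr /= [RHS]big_mkcond /=; apply: eq_big_seq => w wQ.
      by rewrite /F (words_size wQ) leNgt Ll /=.
    by rewrite ler_wpM2l ?mulr_ge0 ?exprn_ge0 // hM.
  have -> : 2 * Q%:R ^+ 2 * (C * expR (- (c * L%:R))) =
    2 * C * (Q%:R ^+ 2 * expR (- (c * L%:R))) by ring.
  rewrite -[leRHS]mulrA; apply: ler_pM; first by lra.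
  - by rewrite mulr_ge0 ?exprn_ge0 ?expR_ge0.
  - by lra.
  rewrite ler_wpM2l ?exprn_ge0 // ler_expR lerN2.
  apply: (@le_trans _ _ (c / 8 * l)); last by nra.
  by rewrite ler_wpM2r // ge_min lexx orbT.
have bF w : w \in rat_words R k Q -> (bad_word s m e Q w)%:R <= F w.
  move=> /mem_rat_words[h1 _ h2 h3 _]; rewrite /bad_word /F -/l.
  have [hl|hl] /= := boolP ((size w)%:R <= l / 8); last first.
    by case: ifP => // h; apply: h3.
  have p0 : (0 < \prod_(d <- w) d)%N.
    rewrite big_seq; elim/big_ind: _ => // [a b a0 b0|d dw].
      by rewrite muln_gt0 a0.
    by rewrite (allP (words_pos h1)).
  rewrite prod_rankin ler_pdivlMr; last by rewrite mulr_gt0 ?sqrtr_gt0 ?ltr0n.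
  by rewrite mul1r; apply: ler_pM; rewrite ?sqrtr_ge0 ?ler0n ?ler_wsqrtr ?ler_nat.
have -> : (count (bad_word s m e Q) (rat_words R k Q))%:R =
    \sum_(w <- rat_words R k Q) (bad_word s m e Q w)%:R :> R.
  by rewrite -sum1_count natr_sum big_mkcond /=; apply: eq_bigr => w _; case: bad_word.
apply: (@le_trans _ _ (\sum_(w <- rat_words R k Q) F w)).
  by rewrite big_seq [leRHS]big_seq; apply: ler_sum.
apply: (@le_trans _ _ (\sum_(w <- flatten [seq words Q L | L <- iota 0 N.+1]) F w)).
  apply: ler_sum_sub; first exact: rat_words_uniq.
    move=> w /mem_rat_words[h1 _ _ _ h2]; apply/flattenP.
    exists (words Q (size w)) => //; apply/map_f; rewrite mem_iota /= add0n ltnS /N.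
    by rewrite truncn_ge_nat //; lra.
  by move=> w /flattenP[ws /mapP[L _ ->]]; apply: F0.
rewrite big_flatten big_map /=.
apply: (@le_trans _ _ (\sum_(L <- iota 0 N.+1) (1 + 2 * C) * Q%:R ^+ 2 * expR (- (c' * l)))).
  by apply: ler_sum.
rewrite big_const_seq count_predT size_iota iter_addr_0 -[_ *+ _]mulr_natl ler_wpM2r //.
  by rewrite !mulr_ge0 ?exprn_ge0 ?expR_ge0 //; lra.
have : N%:R <= 4 * l + 1 by rewrite truncn_le; lra.
rewrite -natr1; lra.
Qed.

Lemma expR_ge_pow4 x : 0 <= x -> (x / 4) ^+ 4 <= expR x.
Proof.
move=> x0; rewrite (_ : expR x = expR (x / 4) ^+ 4); last first.
  by rewrite -expRM_natr; congr expR; field.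
rewrite lerXn2r ?nnegrE ?expR_ge0 //; first by lra.
by have := expR_ge1Dx (x / 4); lra.
Qed.

Lemma count_bad_word_negligible s (e eta : R) : (0 < size s)%N ->
  all (fun d => 0 < d)%N s -> 0 < e <= 1 -> 0 < eta ->
  exists Q0, forall Q k, (Q0 <= Q)%N ->
   (count (bad_word s (gauss_mass R s) e Q) (rat_words R k Q))%:R * ln Q%:R ^+ 2
    <= eta * Q%:R ^+ 2.
Proof.
move=> s1 s0 e01 eta0; have [C [c [C0 c0 [Q0 h]]]] := count_bad_word_le s1 s0 e01.
(* [6 * l] bounds [4 * l + 2] and [256 = 4 ^ 4] comes from [expR_ge_pow4]; the fourth power beats
   the three factors [l] and leaves [B / l]. *)
pose B := 6 * C * 256 / c ^+ 4.
have B0 : 0 < B.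
  by rewrite /B; apply: divr_gt0; [lra | exact: exprn_gt0].
pose l0 := Num.max 1 (B / eta).
exists (maxn Q0 (Num.truncn (expR l0)).+1) => Q k; rewrite geq_max => /andP[QQ Ql].
have {}Ql : l0 <= ln Q%:R.
  have hQ : expR l0 < Q%:R by apply: lt_le_trans (truncnS_gt _) _; rewrite ler_nat.
  rewrite -[l0]expRK ler_ln ?posrE ?expR_gt0 ?(lt_trans _ hQ) ?expR_gt0 //.
  exact: ltW.
have := h Q k QQ; set l := ln Q%:R in Ql *; set n := (count _ _)%:R; set Q2 := Q%:R ^+ 2.
have Q20 : 0 <= Q2 by rewrite exprn_ge0.
move: Ql; rewrite ge_max => /andP[l1 lB].
rewrite ler_pdivrMr // in lB.
move=> /(ler_wpM2r (exprn_ge0 2 (le_trans ler01 l1))) /le_trans; apply.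
have cl0 : 0 < c * l by rewrite mulr_gt0 //; lra.
have := expR_ge_pow4 (ltW cl0) => hE.
have hE2 : expR (- (c * l)) <= 256 / (c ^+ 4 * l ^+ 4).
  rewrite expRN -[leLHS]mul1r ler_pdivrMr ?expR_gt0 // mulrAC ler_pdivlMr; last first.
    by rewrite mulr_gt0 ?exprn_gt0 //; lra.
  by rewrite mul1r; move: hE; rewrite expr_div_n exprMn; lra.
apply: (@le_trans _ _ ((6 * l) * (C * Q2 * (256 / (c ^+ 4 * l ^+ 4))) * l ^+ 2)).
  rewrite ler_wpM2r ?exprn_ge0 //; first by lra.
  apply: ler_pM; first by lra.
  - by rewrite !mulr_ge0 ?expR_ge0 // ltW.
  - by lra.
  by rewrite ler_wpM2l // mulr_ge0 // ltW.
have -> : (6 * l) * (C * Q2 * (256 / (c ^+ 4 * l ^+ 4))) * l ^+ 2 = B / l * Q2.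
  by rewrite /B; field; apply/andP; split; lra.
rewrite ler_wpM2r // ler_pdivrMr; lra.
Qed.

End Counting.

(** * A lower bound for the number of rationals *)


Definition prime_count (n : nat) : nat := count prime (iota 1 n).

Lemma prime_countS n : prime_count n.+1 = (prime_count n + prime n.+1)%N.
Proof.
by have := iotaD 1 n 1; rewrite addn1 /prime_count => ->; rewrite count_cat /= addn0.
Qed.

Lemma prime_count_homo m n : (m <= n)%N -> (prime_count m <= prime_count n)%N.
Proof.
move=> mn; rewrite -(subnKC mn) /prime_count iotaD count_cat; exact: leq_addr.
Qed.

(** Two distinct primes form a fraction selected by each of the three kinds. A new prime denominator
    adds one fraction per smaller prime, which is Pascal's rule. *)
Lemma size_rats_ge k Q : ('C(prime_count Q, 2) <= size (rats k Q))%N.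
Proof.
case: Q => // -[//|Q]; elim: Q => [//|Q IH].
rewrite rats_recr size_cat prime_countS size_map size_filter.
case: (boolP (prime Q.+3)) => pQ; last first.
  by rewrite addn0; apply: leq_trans IH _; rewrite leq_addr.
rewrite addn1 binS bin1 leq_add //.
rewrite /prime_count (@eq_in_count _ _ (fun p => prime p && (p < Q.+3)%N)); last first.
  by move=> p; rewrite mem_iota add1n => /andP[_ ->]; rewrite andbT.
apply: sub_count => p /andP[pp pQ'].
have cp : coprime p Q.+3.
  by rewrite prime_coprime // dvdn_prime2 // ltn_eqF.
by rewrite cp /=; case: k {IH} => //=; rewrite ?pp ?pQ.
Qed.

(** * Chebyshev's bound from the central binomial coefficient *)

Lemma expn2_fact_le m : (2 ^ m * (m`! * m`!) <= (2 * m)`!)%N.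
Proof.
elim: m => // m IH; rewrite mulnS !factS expnS.
rewrite [leqRHS]mulnA; apply: leq_trans (leq_mul (leqnn _) IH).
rewrite (_ : 2 * 2 ^ m * _ = (2 * m.+1 * m.+1) * (2 ^ m * (m`! * m`!)))%N; last by ring.
by rewrite leq_mul2r; apply/orP; right; nia.
Qed.

Lemma expn2_le_bin m : (2 ^ m <= 'C(2 * m, m))%N.
Proof.
have := expn2_fact_le m; rewrite -(@bin_fact (2 * m) m); last by lia.
rewrite (_ : 2 * m - m = m)%N; last by lia.
by rewrite leq_pmul2r // muln_gt0 !fact_gt0.
Qed.

Lemma sum_leq_le N e : (\sum_(1 <= k < N.+1) (k <= e) <= e)%N.
Proof.
suff : (\sum_(1 <= k < N.+1) (k <= e) <= minn N e)%N.
  by move/leq_trans; apply; rewrite geq_minr.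
elim: N => [|N IH]; first by rewrite big_geq.
rewrite big_nat_recr //=; lia.
Qed.

(** In Legendre's formula the k-th term is [2 * m %/ p ^ k - 2 * (m %/ p ^ k)], which is at most 1
    and vanishes once [p ^ k > 2 * m]. *)
Lemma logn_bin_le p m : prime p -> (0 < m)%N ->
  (logn p 'C(2 * m, m) <= trunc_log p (2 * m))%N.
Proof.
move=> pp m0; have p1 := prime_gt1 pp.
have C0 : (0 < 'C(2 * m, m))%N by rewrite bin_gt0; lia.
have := logn_fact (2 * m) pp; rewrite -(@bin_fact (2 * m) m); last by lia.
rewrite (_ : 2 * m - m = m)%N; last by lia.
rewrite lognM ?muln_gt0 ?fact_gt0 // lognM ?fact_gt0 // logn_fact // => h.
have ext : (\sum_(1 <= k < (2 * m).+1) m %/ p ^ k = \sum_(1 <= k < m.+1) m %/ p ^ k)%N.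
  rewrite (big_cat_nat (n := m.+1)) //=; last by lia.
  rewrite [X in (_ + X)%N]big_nat_cond [X in (_ + X)%N]big1 ?addn0 // => i /andP[/andP[mi _] _].
  by rewrite divn_small //; apply: leq_trans (ltn_expl i p1); lia.
rewrite -ext in h.
have : (\sum_(1 <= k < (2 * m).+1) 2 * m %/ p ^ k <=
   \sum_(1 <= k < (2 * m).+1) (m %/ p ^ k + m %/ p ^ k + (k <= trunc_log p (2 * m))))%N.
  apply: leq_sum => i _.
  have pi0 : (0 < p ^ i)%N by rewrite expn_gt0 prime_gt0.
  have [hi|hi] := leqP (p ^ i) (2 * m); last by rewrite divn_small.
  rewrite trunc_log_max //.
  rewrite -ltnS ltn_divLR //.
  have := ltn_ceil m pi0; nia.
rewrite !big_split /= => h2.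
have := sum_leq_le (2 * m) (trunc_log p (2 * m)); lia.
Qed.

Lemma leq_prod_expn (l : seq nat) (f : nat -> nat) B :
  {in l, forall i, (f i <= B)%N} -> (\prod_(i <- l) f i <= B ^ size l)%N.
Proof.
elim: l => [|a l IH] h; first by rewrite big_nil.
rewrite big_cons expnS leq_mul ?h ?mem_head // IH // => i il.
by rewrite h // inE il orbT.
Qed.

Lemma bin_le_expn_prime_count m : (0 < m)%N ->
  ('C(2 * m, m) <= (2 * m) ^ prime_count (2 * m))%N.
Proof.
move=> m0; have C0 : (0 < 'C(2 * m, m))%N by rewrite bin_gt0; lia.
rewrite {1}(prod_prime_decomp C0) prime_decompE big_map /=.
apply: (@leq_trans ((2 * m) ^ size (primes 'C(2 * m, m)))).
  apply: leq_prod_expn => p; rewrite mem_primes => /and3P[pp _ _].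
  apply: leq_trans (trunc_logP (prime_gt1 pp) _); last by lia.
  by rewrite leq_exp2l ?prime_gt1 // logn_bin_le.
rewrite leq_pexp2l //; first by lia.
rewrite /prime_count -size_filter uniq_leq_size ?primes_uniq // => p.
rewrite mem_primes => /and3P[pp _ pd]; rewrite mem_filter pp mem_iota prime_gt0 //=.
rewrite add1n ltnS leqNgt; apply/negP => h.
have : (p %| (2 * m)`!)%N by rewrite -(@bin_fact (2 * m) m) ?dvdn_mulr //; lia.
rewrite -[X in (X %| _)%N](expn1 p) pfactor_dvdn ?fact_gt0 // logn_fact //.
rewrite big_nat_cond big1 // => i /andP[/andP[i1 _] _]; rewrite divn_small //.
by apply: leq_trans h _; case: i i1 => // i _; rewrite expnS leq_pmulr // expn_gt0 prime_gt0.
Qed.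

Section PrimeBound.
Variable R : realType.

(** Logarithms of [2 ^ m <= Q ^ prime_count Q] with [m = Q./2]; the 6 comes from [m >= Q / 3] and
    [ln 2 >= 1/2]. *)
Lemma prime_count_ge Q : (1 < Q)%N ->
  Q%:R / 6 <= (prime_count Q)%:R * ln Q%:R :> R.
Proof.
move=> Q1; pose m := Q./2.
have m0 : (0 < m)%N by rewrite /m; lia.
have mQ : (2 * m <= Q)%N by rewrite /m; lia.
have Qm : (Q <= 3 * m)%N by rewrite /m; lia.
have h : (2 ^ m <= Q ^ prime_count Q)%N.
  apply: leq_trans (expn2_le_bin m) (leq_trans (bin_le_expn_prime_count m0) _).
  apply: (@leq_trans (Q ^ prime_count (2 * m))).
    by case: (prime_count (2 * m)) => // n; rewrite leq_exp2r.
  by rewrite leq_pexp2l ?prime_count_homo // ltnW.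
have Q0 : 0 < Q%:R :> R by rewrite ltr0n ltnW.
have : ln (2 ^ m)%N%:R <= ln (Q ^ prime_count Q)%N%:R :> R.
  by rewrite ler_ln ?posrE ?ltr0n ?expn_gt0 ?ler_nat // ltnW.
rewrite !natrX !lnXn // -[ln 2 *+ _]mulr_natl -[ln Q%:R *+ _]mulr_natl.
apply: le_trans; have l2 := ln2_ge_half R.
have : Q%:R <= 3 * m%:R :> R by rewrite -natrM ler_nat.
have : 0 <= m%:R :> R by rewrite ler0n.
nra.
Qed.

(** [144 = 4 * 6 ^ 2], the 4 because [n ^ 2 <= 4 * 'C(n, 2)] for [n >= 2]. *)
Lemma size_rats_lower k Q : (2 < Q)%N ->
  Q%:R ^+ 2 <= 144 * (size (rats k Q))%:R * ln Q%:R ^+ 2 :> R.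
Proof.
move=> Q2; have Q1 : (1 < Q)%N by apply: ltnW.
have h := prime_count_ge Q1.
have p2 : (2 <= prime_count Q)%N by rewrite -[2%N]/(prime_count 3) prime_count_homo.
have hs : (prime_count Q * prime_count Q <= 4 * size (rats k Q))%N.
  have := size_rats_ge k Q; rewrite bin2 => hC.
  have := odd_double_half (prime_count Q * (prime_count Q).-1).
  have -> : odd (prime_count Q * (prime_count Q).-1) = false.
    by rewrite oddM; case: (prime_count Q) => //= n; case: odd.
  nia.
have {}hs : (prime_count Q)%:R ^+ 2 <= 4 * (size (rats k Q))%:R :> R.
  by rewrite expr2 -!natrM ler_nat.
have l0 : 0 <= ln Q%:R :> R by rewrite ln_ge0 // ler1n ltnW.
have : (Q%:R / 6) ^+ 2 <= ((prime_count Q)%:R * ln Q%:R) ^+ 2 :> R.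
  by rewrite lerXn2r ?nnegrE ?divr_ge0 ?mulr_ge0 ?ler0n.
rewrite exprMn => h1.
have := ler_wpM2r (exprn_ge0 2 l0) hs.
move: h1; rewrite exprMn; lra.
Qed.

End PrimeBound.

(** * Frequencies in the concatenation *)


Section Concatenation.
Variable R : realType.
Implicit Types (x : R) (w s : seq nat) (d : nat -> nat).

Definition hit d s i : bool := all (fun j => d (i + j)%N == nth 0%N s j) (iota 0 (size s)).

Lemma hit_prefix d s w o i : (i + size s <= size w)%N ->
  (forall j, (j < size w)%N -> d (o + j)%N = nth 0%N w j) ->
  hit d s (o + i) = prefix s (drop i w).
Proof.
move=> isw dw; rewrite prefixE.
have sz : size (take (size s) (drop i w)) = size s.
  by rewrite size_takel // size_drop; lia.
apply/allP/eqP => [h|h j].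
  apply: (@eq_from_nth _ 0%N) => // j; rewrite sz => js.
  rewrite nth_take // nth_drop -dw; last by lia.
  by rewrite addnA; apply/eqP; apply: h; rewrite mem_iota.
rewrite mem_iota => /andP[_ js]; rewrite -addnA dw; last by lia.
by rewrite -nth_drop -(nth_take 0%N (n0 := size s)) ?h //; lia.
Qed.

(** Only windows that run over the end of [w] can differ, and these start at the last [size s]
    positions. *)
Lemma deviation_hit d s (m : R) w o :
  (forall j, (j < size w)%N -> d (o + j)%N = nth 0%N w j) ->
  `|\sum_(0 <= i < size w) ((hit d s (o + i))%:R - m) - deviation s m w| <= (size s)%:R.
Proof.
move=> dw; rewrite /deviation -sumrB; set n := size w; set k := size s.
rewrite (big_cat_nat (n := (n - k)%N)) //=; last by rewrite leq_subr.
rewrite big_nat_cond [X in `|X + _|]big1 ?add0r; last first.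
  move=> i /andP[/andP[_ ink] _]; rewrite /centered (hit_prefix _ dw) ?subrr //.
  rewrite -/n -/k; lia.
apply: le_trans (ler_norm_sum _ _ _) _.
apply: (@le_trans _ _ (\sum_(n - k <= i < n) 1)).
  apply: ler_sum => i _; rewrite /centered ler_norml.
  by case: hit; case: prefix => /=; lra.
by rewrite sumr_const_nat ler_nat; lia.
Qed.

Lemma deviation_hit_flatten d s (m : R) ws o :
  (forall j, (j < size (flatten ws))%N -> d (o + j)%N = nth 0%N (flatten ws) j) ->
  `|\sum_(0 <= i < size (flatten ws)) ((hit d s (o + i))%:R - m) -
    \sum_(w <- ws) deviation s m w| <= (size s * size ws)%:R.
Proof.
elim: ws o => [|w ws IH] o /=.
  by move=> _; rewrite big_geq // big_nil subrr normr0 ler0n.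
rewrite size_cat => h.
have h1 j : (j < size w)%N -> d (o + j)%N = nth 0%N w j.
  by move=> jw; rewrite h ?nth_cat ?jw //; lia.
have h2 j : (j < size (flatten ws))%N -> d (o + size w + j)%N = nth 0%N (flatten ws) j.
  by move=> jw; rewrite -addnA h ?nth_cat ?ltnNge ?leq_addr ?addKn //=; lia.
rewrite (big_cat_nat (n := size w)) //=; last by rewrite leq_addr.
rewrite big_cons -{2}[size w]add0n big_addn addKn.
have -> : \sum_(0 <= i < size (flatten ws)) ((hit d s (o + (i + size w)))%:R - m) =
   \sum_(0 <= i < size (flatten ws)) ((hit d s (o + size w + i))%:R - m).
  by apply: eq_bigr => i _; rewrite addnA addnAC.
have := IH _ h2; have := deviation_hit s m h1.
set A := \sum_(_ <= _ < _) _; set B := \sum_(_ <= _ < _) _.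
set D1 := deviation _ _ _; set D2 := \sum_(_ <- _) _ => a b.
rewrite (_ : A + B - (D1 + D2) = (A - D1) + (B - D2)); last by ring.
apply: le_trans (ler_normD _ _) _; rewrite mulnS natrD; exact: lerD.
Qed.

Lemma flatten_cut (ws : seq (seq nat)) N (B : R) :
  {in ws, forall w, (size w)%:R <= B} -> 0 <= B -> (N <= size (flatten ws))%N ->
  exists T, (size (flatten (take T ws)) <= N)%N /\
    N%:R <= (size (flatten (take T ws)))%:R + B.
Proof.
elim: ws N => [|w ws IH] N h B0 /=.
  by rewrite leqn0 => /eqP ->; exists 0%N; rewrite add0r.
rewrite size_cat => Nw; have [Nw1|Nw1] := leqP (size w) N; last first.
  exists 0%N; split => //; rewrite add0r; apply: le_trans (h w _); last exact: mem_head.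
  by rewrite ler_nat ltnW.
have h' : {in ws, forall w, (size w)%:R <= B} by move=> v vw; apply: h; rewrite inE vw orbT.
have [|T [T1 T2]] := IH (N - size w)%N h' B0; first by lia.
exists T.+1; rewrite /= size_cat natrD; split; first by lia.
by move: T2; rewrite natrB //; lra.
Qed.

Lemma deviation_norm_le s (m : R) w : 0 <= m <= 1 -> `|deviation s m w| <= (size w)%:R.
Proof. by move=> m01; rewrite /deviation -{2}[size w]subn0 sum_centered_norm_le. Qed.

Lemma size_flattenR (ws : seq (seq nat)) :
  (size (flatten ws))%:R = \sum_(w <- ws) (size w)%:R :> R.
Proof.
elim: ws => [|w ws IH]; first by rewrite big_nil.
by rewrite /= size_cat natrD IH big_cons.
Qed.

(** Good words cost [e] per digit, bad ones at most their whole length. *)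
Lemma sum_deviation_le s (m e B : R) Q (ws : seq (seq nat)) : 0 <= m <= 1 -> 0 <= e ->
  0 <= B -> {in ws, forall w, (size w)%:R <= B} ->
  `|\sum_(w <- ws) deviation s m w| <=
  e * (size (flatten ws))%:R + (count (bad_word s m e Q) ws)%:R * B.
Proof.
move=> m01 e0 B0 hB; apply: le_trans (ler_norm_sum _ _ _) _.
rewrite size_flattenR -sum1_count natr_sum [X in _ + X * _]big_mkcond /=.
rewrite big_distrr big_distrl -big_split /= big_seq [leRHS]big_seq.
apply: ler_sum => w ww; have := deviation_norm_le s w m01; have := hB w ww.
case: ifP => hb.
  have : 0 <= (size w)%:R :> R by rewrite ler0n.
  rewrite mul1r; nra.
move: hb; rewrite /bad_word mul0r addr0 => /norP[_]; rewrite -ltNge => /ltW //.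
Qed.

Lemma size_flatten_ge s (m e : R) Q (ws : seq (seq nat)) : 0 <= ln (Q%:R : R) ->
  ((size ws)%:R - (count (bad_word s m e Q) ws)%:R) * (ln Q%:R / 8) <=
  (size (flatten ws))%:R :> R.
Proof.
move=> l0; rewrite size_flattenR -(count_predC (bad_word s m e Q) ws) natrD addrAC subrr add0r.
rewrite -sum1_count natr_sum big_mkcond /= big_distrl /=.
apply: ler_sum => w _; case: ifP => hb; last by rewrite mul0r ler0n.
by move: hb; rewrite /bad_word mul1r => /norP[]; rewrite -ltNge => /ltW.
Qed.

(** A crude consequence of [ln Q <= 2 * sqrt Q], whence [576 = 4 * 144]. It makes the prefixes
    unbounded and a single word negligible. *)
Lemma size_rats_linear k Q : (2 < Q)%N -> Q%:R <= 576 * (size (rats k Q))%:R :> R.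
Proof.
move=> Q2; have := size_rats_lower R k Q2; set v : R := (size _)%:R.
have Q0 : 0 < Q%:R :> R by rewrite ltr0n; lia.
have l0 : 0 <= ln Q%:R :> R by rewrite ln_ge0 // ler1n; lia.
have hs : Num.sqrt Q%:R ^+ 2 = Q%:R :> R by rewrite sqr_sqrtr // ltW.
have hl : ln Q%:R <= 2 * Num.sqrt Q%:R :> R.
  rewrite -{1}hs lnXn ?sqrtr_gt0 // -[_ *+ 2]mulr_natl ler_wpM2l //.
  have s0 : 0 < Num.sqrt Q%:R :> R by rewrite sqrtr_gt0.
  by have := expR_ge1Dx (ln (Num.sqrt Q%:R) : R); rewrite lnK ?posrE //; lra.
have hl2 : ln Q%:R ^+ 2 <= 4 * Q%:R :> R.
  rewrite -[in leRHS]hs (_ : 4 * _ = (2 * Num.sqrt Q%:R) ^+ 2); last by ring.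
  by rewrite lerXn2r ?nnegrE ?mulr_ge0 ?sqrtr_ge0.
have v0 : 0 <= v by rewrite ler0n.
move=> h; have {}h : Q%:R ^+ 2 <= 576 * v * Q%:R.
  by apply: le_trans h _; nra.
by rewrite -(ler_pM2r Q0) -expr2.
Qed.

Lemma rat_words_recr k Q : exists l, rat_words R k Q.+2 = rat_words R k Q.+1 ++ l.
Proof. by rewrite /rat_words rats_recr map_cat; eexists. Qed.

Lemma size_rat_words k Q : size (rat_words R k Q) = size (rats k Q).
Proof. by rewrite size_map. Qed.

Lemma size_rats_le_flatten k Q : (size (rats k Q) <= size (flatten (rat_words R k Q)))%N.
Proof.
rewrite -size_rat_words; have : {in rat_words R k Q, forall w, (0 < size w)%N}.
  by move=> w /mem_rat_words[].
elim: (rat_words R k Q) => //= w ws IH h; rewrite size_cat.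
have := h w (mem_head _ _); have H : (size ws <= size (flatten ws))%N.
  by apply: IH => v vw; apply: h; rewrite inE vw orbT.
lia.
Qed.

Lemma concat_prefix_homo k Q Q' : (Q <= Q')%N ->
  (size (concat_prefix R k Q) <= size (concat_prefix R k Q'))%N.
Proof.
move=> /subnKC <-; elim: (Q' - Q)%N => [|n IH]; first by rewrite addn0.
apply: leq_trans IH _; rewrite addnS !concat_prefixE; case: (Q + n)%N => // a.
by have [l ->] := rat_words_recr k a; rewrite flatten_cat size_cat leq_addr.
Qed.

Lemma concat_prefix_unbounded k N : exists Q, (N < size (concat_prefix R k Q))%N.
Proof.
exists (576 * N.+1).+2; rewrite concat_prefixE.
apply: leq_trans (size_rats_le_flatten _ _).
have := @size_rats_linear k (576 * N.+1).+2 isT; rewrite -natrM ler_nat; lia.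
Qed.

Lemma sum_hit_norm_le d s (m : R) a b : 0 <= m <= 1 -> (a <= b)%N ->
  `|\sum_(a <= i < b) ((hit d s i)%:R - m)| <= b%:R - a%:R.
Proof.
move=> /andP[m0 m1] ab; apply: le_trans (ler_norm_sum _ _ _) _.
rewrite -natrB // -[leRHS]mulr1 mulr_natl -sumr_const_nat.
by apply: ler_sum => i _; rewrite ler_norml; case: hit => /=; lra.
Qed.

(** A cut among the denominators [Q] surely includes only the rationals up to [Q - 1], whereas bad
    words are counted up to [Q]; [Q <= 2 * (Q - 1)] costs a factor 4. *)
Lemma rats_pred_quadratic k Q : (4 < Q)%N ->
  Q%:R ^+ 2 <= 576 * (size (rats k Q.-1))%:R * ln Q%:R ^+ 2 :> R.
Proof.
case: Q => // Q; rewrite ltnS => Q4; have Q2 : (2 < Q)%N by apply: ltnW.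
have Q0 : (0 < Q)%N by apply: ltn_trans Q2.
have := size_rats_lower R k Q2; rewrite [Q.+1.-1]/=.
have h2 : Q.+1%:R <= 2 * Q%:R :> R by rewrite -natrM ler_nat mul2n -addnn -addn1 leq_add2l.
have h3 : ln (Q%:R : R) <= ln (Q.+1%:R : R) by rewrite ler_ln ?posrE ?ltr0n ?ler_nat.
have h31 : 0 <= ln (Q%:R : R) by rewrite ln_ge0 // ler1n.
have h4 : ln (Q%:R : R) ^+ 2 <= ln Q.+1%:R ^+ 2.
  by rewrite lerXn2r ?nnegrE ?(le_trans h31 h3).
have h5 : Q.+1%:R ^+ 2 <= (2 * Q%:R) ^+ 2 :> R.
  by rewrite lerXn2r ?nnegrE ?mulr_ge0 ?ler0n.
have h6 := ler_wpM2l (ler0n R (size (rats k Q))) h4.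
move: h5; rewrite exprMn; lra.
Qed.

Lemma rats_pred_linear k Q : (4 < Q)%N -> Q%:R <= 1152 * (size (rats k Q.-1))%:R :> R.
Proof.
case: Q => // Q; rewrite ltnS => Q4; have Q2 : (2 < Q)%N by apply: ltnW.
have Q0 : (0 < Q)%N by apply: ltn_trans Q2.
have := size_rats_linear k Q2; rewrite [Q.+1.-1]/=.
have : Q.+1%:R <= 2 * Q%:R :> R by rewrite -natrM ler_nat mul2n -addnn -addn1 leq_add2l.
lra.
Qed.

(** Here [v] words, [b] of them bad, have [n] digits, [l = ln Q] and [z = size s]. Since
    [n >= v * l / 16], word boundaries, bad words and the cut word cost at most [e * n] each, and
    the good words another [e * n]. *)
Lemma prefix_arith (e z v l b n : R) : 0 < e <= 1 -> 1 <= l -> 16 * z <= l * e ->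
  80 <= v * e -> 0 <= b -> b <= e / 160 * v -> (v - b) * (l / 8) <= n ->
  z * v + (e * n + b * (4 * l + 1)) + (4 * l + 1) <= 4 * e * n.
Proof.
move=> /andP[e0 e1] l1 zl ve b0 bv hn.
have v0 : 0 < v by rewrite -(pmulr_lgt0 _ e0); lra.
have nv : v * l / 16 <= n.
  have : b <= v / 2 by nra.
  nra.
have F1 : z * v <= e * (v * l / 16).
  have := ler_wpM2l (ltW v0) zl; lra.
have F2 : 4 * l + 1 <= e * (v * l / 16).
  have : 80 * l <= v * e * l by rewrite ler_wpM2r //; lra.
  lra.
have F3 : b * (4 * l + 1) <= e * (v * l / 16).
  apply: (@le_trans _ _ (e / 160 * v * (5 * l))); last by nra.
  by apply: ler_pM => //; lra.
have := ler_wpM2l (ltW e0) nv; lra.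
Qed.

Lemma rat_words_prefix k d N Q : is_concat R k d -> (1 < Q)%N ->
  (size (concat_prefix R k Q.-1) <= N)%N -> (N < size (concat_prefix R k Q))%N ->
  exists vs us, [/\ rat_words R k Q = vs ++ us, (size (rats k Q.-1) <= size vs)%N,
    (size (flatten vs) <= N)%N, N%:R <= (size (flatten vs))%:R + (4 * ln Q%:R + 1) :> R
    & forall j, (j < size (flatten vs))%N -> d j = nth 0%N (flatten vs) j].
Proof.
move=> dc Q1 NQ' NQ.
have [l hl] : exists l, rat_words R k Q = rat_words R k Q.-1 ++ l.
  by case: Q Q1 {NQ NQ'} => [|[|Q]] // _; apply: rat_words_recr.
rewrite !concat_prefixE in NQ NQ'.
pose B : R := 4 * ln Q%:R + 1.
have B0 : 0 <= B by rewrite addr_ge0 ?mulr_ge0 ?ln_ge0 ?ler1n // ltnW.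
have hBl : {in l, forall w, (size w)%:R <= B}.
  move=> w wl; have : w \in rat_words R k Q by rewrite hl mem_cat wl orbT.
  by move=> /mem_rat_words[].
set n1 := size (flatten (rat_words R k Q.-1)) in NQ'.
have hN : (N - n1 <= size (flatten l))%N.
  by move: NQ; rewrite hl flatten_cat size_cat -/n1 leq_subLR => /ltnW.
have [T [T1 T2]] := flatten_cut hBl B0 hN.
exists (rat_words R k Q.-1 ++ take T l), (drop T l).
have vsQ : rat_words R k Q = (rat_words R k Q.-1 ++ take T l) ++ drop T l.
  by rewrite -catA cat_take_drop.
split => //.
- by rewrite size_cat size_rat_words leq_addr.
- by rewrite flatten_cat size_cat -/n1 -(subnKC NQ') leq_add2l.
- rewrite flatten_cat size_cat -/n1 natrD; move: T2; rewrite natrB // /B; lra.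
move=> j jv; rewrite (dc Q) concat_prefixE vsQ flatten_cat ?nth_cat ?jv //.
by rewrite size_cat ltn_addr.
Qed.

Lemma deviation_prefix_le (k : subseq_kind) s (e : R) : (0 < size s)%N ->
  all (fun a => 0 < a)%N s -> 0 < e <= 1 ->
  exists N0, forall d N, is_concat R k d -> (N0 <= N)%N ->
  `|\sum_(0 <= i < N) ((hit d s i)%:R - gauss_mass R s)| <= 4 * e * N%:R.
Proof.
move=> s1 s0 e01; have /andP[e0 e1] := e01; set m := gauss_mass R s.
have m01 : 0 <= m <= 1 by apply: gauss_mass_itv.
(* [e / 160] is the share of bad words that [prefix_arith] tolerates; 576 is lost in
   [rats_pred_quadratic]. *)
have eta0 : 0 < e / 160 / 576 by lra.
have [Q1 hQ1] := count_bad_word_negligible s1 s0 e01 eta0.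
pose l0 : R := Num.max 1 (16 * (size s)%:R / e).
pose Q2 := (Num.truncn (expR l0)).+1.
pose Q3 := (Num.truncn (1152 * 80 / e)).+1.
pose Q0 := maxn 4 (maxn Q1 (maxn Q2 Q3)).
exists (size (concat_prefix R k Q0)) => d N dc N0.
(* The least such [Q]: the prefix for [Q - 1] still fits into [N], and the choice of the threshold
   forces [Q > Q0]. *)
have [Q NQ Qmin] := ex_minnP (concat_prefix_unbounded k N).
have QQ0 : (Q0 < Q)%N.
  rewrite ltnNge; apply/negP => h; have := concat_prefix_homo k h.
  by move=> h'; have := leq_ltn_trans N0 (leq_trans NQ h'); rewrite ltnn.
move: QQ0; rewrite /Q0 !gtn_max => /and4P[Q4 QQ1 QQ2 QQ3].
have Qpos : (0 < Q)%N by apply: leq_trans Q4.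
have NQ' : (size (concat_prefix R k Q.-1) <= N)%N.
  by rewrite leqNgt; apply/negP => /Qmin; rewrite -{1}(prednK Qpos) ltnn.
have Qgt1 : (1 < Q)%N by apply: leq_trans Q4.
have [vs [us [vsQ vQ n0N Nn0 dvs]]] := rat_words_prefix dc Qgt1 NQ' NQ.
have hBv : {in vs, forall w, (size w)%:R <= 4 * ln Q%:R + 1 :> R}.
  move=> w wv; have : w \in rat_words R k Q by rewrite vsQ mem_cat wv.
  by move=> /mem_rat_words[].
have Q0' : 0 < Q%:R :> R by rewrite ltr0n.
have hla : l0 <= ln Q%:R.
  have hQ : expR l0 < Q%:R.
    by apply: lt_le_trans (truncnS_gt _) _; rewrite ler_nat ltnW.
  by rewrite -[l0]expRK ler_ln ?posrE ?expR_gt0 // ltW.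
move: hla; rewrite ge_max ler_pdivrMr // => /andP[la1 las].
have la0 : 0 <= ln (Q%:R : R) by apply: le_trans la1.
have vle : (size (rats k Q.-1))%:R <= (size vs)%:R :> R by rewrite ler_nat.
have vlin : 80 <= (size vs)%:R * e.
  have := rats_pred_linear k Q4.
  have : 1152 * 80 / e < Q%:R.
    by apply: lt_le_trans (truncnS_gt _) _; rewrite ler_nat ltnW.
  rewrite ltr_pdivrMr // => h1 h2.
  have := ler_wpM2r (ltW e0) h2; have := ler_wpM2r (ltW e0) vle; lra.
set b : R := (count (bad_word s m e Q) vs)%:R.
have b0 : 0 <= b by rewrite ler0n.
have bv : b <= e / 160 * (size vs)%:R.
  have la20 : 0 < ln (Q%:R : R) ^+ 2 by rewrite exprn_gt0 //; lra.
  rewrite -(ler_pM2r la20).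
  apply: le_trans (_ : e / 160 / 576 * Q%:R ^+ 2 <= _).
    apply: le_trans (hQ1 Q k (ltnW QQ1)); rewrite ler_wpM2r ?(ltW la20) //.
    by rewrite ler_nat vsQ count_cat leq_addr.
  apply: le_trans (ler_wpM2l (ltW eta0) (rats_pred_quadratic k Q4)) _.
  have := ler_wpM2r (ltW la20) vle; rewrite -!mulrA => h.
  have := ler_wpM2l (ltW e0) h; lra.
have n0v := @size_flatten_ge s m e Q vs la0.
have E1 := @deviation_hit_flatten d s m vs 0 dvs.
have B0 : 0 <= 4 * ln (Q%:R : R) + 1 by lra.
have E2 := @sum_deviation_le s m e _ Q vs m01 (ltW e0) B0 hBv.
rewrite (big_cat_nat _ n0N) //=.
have E3 := sum_hit_norm_le d s m01 n0N.
have E4 := prefix_arith e01 la1 las vlin b0 bv n0v.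
have E5 : 4 * e * (size (flatten vs))%:R <= 4 * e * N%:R.
  by rewrite ler_wpM2l ?ler_nat //; lra.
apply: le_trans (ler_normD _ _) _; apply: le_trans (le_trans E4 E5).
apply: lerD; last by apply: le_trans E3 _; rewrite lerBlDl.
set S := \sum_(0 <= _ < _) _; set D := \sum_(_ <- vs) _ in E1 E2.
rewrite -[S](subrK D); apply: le_trans (ler_normD _ _) _; apply: lerD => //.
by rewrite -natrM.
Qed.

Lemma occE d s N x : has_cf x d -> (occ s N x)%:R = \sum_(0 <= i < N) (hit d s i)%:R :> R.
Proof.
move=> [_ dx]; rewrite /occ -[1%N]addn0 iotaDl count_map.
rewrite (@eq_count _ _ (hit d s)); last first.
  by move=> i; apply: eq_all => j; rewrite add1n addSn dx.
rewrite -sum1_count natr_sum /index_iota subn0 big_mkcond /=.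
by apply: eq_bigr => i _; case: hit.
Qed.

Lemma occ_cvg k d s x : is_concat R k d -> has_cf x d -> (0 < size s)%N ->
  all (fun a => 0 < a)%N s ->
  (fun N => (occ s N x)%:R / N%:R : R) @ \oo --> gauss_mass R s.
Proof.
move=> dc dx s1 s0; apply/cvgrPdist_le => e e0.
pose e' := Num.min 1 (e / 4).
have e'01 : 0 < e' <= 1 by rewrite /e' lt_min ge_min lexx ltr01 /= andbT; lra.
have [N0 hN0] := deviation_prefix_le k s1 s0 e'01.
exists (maxn 1 N0) => // N /=; rewrite geq_max => /andP[N1 NN0].
have N0' : 0 < N%:R :> R by rewrite ltr0n.
have := hN0 d N dc NN0; rewrite sumrB -(occE s N dx) sumr_const_nat subn0 => h.
have -> : gauss_mass R s - (occ s N x)%:R / N%:R =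
   - (((occ s N x)%:R - gauss_mass R s *+ N) / N%:R).
  by rewrite -mulr_natr; field; rewrite gt_eqF.
rewrite normrN normrM [`|N%:R^-1|]ger0_norm ?invr_ge0 ?(ltW N0') // ler_pdivrMr //.
apply: le_trans h _; rewrite ler_wpM2r ?(ltW N0') //.
have : e' <= e / 4 by rewrite /e' ge_min lexx orbT.
lra.
Qed.

End Concatenation.

(** * The Gauss measure of a cylinder *)


Section CylinderMeasure.
Variable R : realType.
Implicit Types (x y : R) (s : seq nat).

(** Symmetric in the ends, as [cf_eval s] reverses orientation for odd length. *)
Definition between (u v x : R) : bool := (u <= x <= v) || (v <= x <= u).

Lemma between_inv_digit (a : nat) (u v x : R) : (0 < a)%N -> 0 <= u -> 0 <= v -> 0 < x ->
  between (a%:R + u)^-1 (a%:R + v)^-1 x = between u v (x^-1 - a%:R).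
Proof.
move=> /(natr_ge1 R) a1 u0 v0 x0; rewrite /between orbC.
have hl (t : R) : 0 <= t -> ((a%:R + t)^-1 <= x) = (x^-1 - a%:R <= t).
  move=> t0; rewrite -[X in _ <= X]invrK lef_pV2 ?posrE ?invr_gt0 //; last by lra.
  by rewrite lerBlDl.
have hr (t : R) : 0 <= t -> (x <= (a%:R + t)^-1) = (t <= x^-1 - a%:R).
  move=> t0; rewrite -[X in X <= _]invrK lef_pV2 ?posrE ?invr_gt0 //; last by lra.
  by rewrite lerBrDl.
by rewrite !hl // !hr // andbC [X in _ || X]andbC.
Qed.

Lemma gauss_itv x : 0 < x < 1 -> 0 <= gauss x < 1.
Proof.
move=> /andP[x0 x1]; rewrite /gauss gt_eqF //.
have xV : 0 <= x^-1 by rewrite invr_ge0 ltW.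
have /andP[h1 h2] := truncn_itv xV.
by rewrite subr_ge0 h1 ltrBlDl natr1 h2.
Qed.

Definition irrational x := ~ range (@ratr R) x.

Lemma irrational_neq_nat x (n : nat) : irrational x -> x != n%:R.
Proof.
by move=> ix; apply/eqP => xn; apply: ix; exists n%:R => //; rewrite ratr_nat.
Qed.

Lemma irrational_inv x : irrational x -> irrational x^-1.
Proof.
move=> ix [q _ qx]; apply: ix; exists q^-1 => //.
by rewrite fmorphV /= qx invrK.
Qed.

Lemma irrational_subn x (n : nat) : irrational x -> irrational (x - n%:R).
Proof.
move=> ix [q _ qx]; apply: ix; exists (q + n%:R) => //.
by rewrite rmorphD /= qx ratr_nat subrK.
Qed.

(** Irrational points have infinite expansions and avoid the rational ends, so cylinder and closed
    interval agree on them; the induction follows the Gauss map. *)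
Lemma cylinder_between s x : all (fun d => 0 < d)%N s -> irrational x ->
  0 <= x < 1 -> cylinder s x <-> between (cf_eval s 0) (cf_eval s 1) x.
Proof.
have z01 : 0 <= (0 : R) <= 1 by rewrite lexx ler01.
have o01 : 0 <= (1 : R) <= 1 by rewrite lexx ler01.
elim: s x => [|a s IH] x /=.
  move=> _ ix x01; rewrite /cylinder /between /=; split => // _.
  by case/andP: x01 => -> /ltW ->.
move=> /andP[a0 s0] ix /andP[x0 x1].
have xgt0 : 0 < x by rewrite lt_neqAle eq_sym x0 andbT (irrational_neq_nat 0 ix).
have iV := irrational_inv ix.
have /andP[u0 u1] := cf_eval_itv s0 z01; have /andP[v0 v1] := cf_eval_itv s0 o01.
rewrite between_inv_digit //.
have gE : gauss x = x^-1 - (Num.truncn x^-1)%:R by rewrite /gauss gt_eqF.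
have ig : irrational (gauss x) by rewrite gE; apply: irrational_subn.
have g0 : gauss x != 0 by apply: (irrational_neq_nat 0 ig).
have g01 : 0 <= gauss x < 1 by apply: gauss_itv; rewrite xgt0.
have d1 : cf_digit x 1 = Some (Num.truncn x^-1).
  by rewrite /cf_digit /gauss_orbit /= gt_eqF // (negbTE g0).
have cyl : cylinder (a :: s) x <-> Num.truncn x^-1 = a /\ cylinder s (gauss x).
  split => [[_ h]|[ta [_ h]]].
    have := h 0%N isT; rewrite d1 /= => -[ta]; split => //; split => // j js.
    by rewrite -cf_digit_shift // h.
  split; first by rewrite x0.
  by move=> [|j] js; [rewrite d1 ta | rewrite cf_digit_shift // h].
rewrite cyl; split => [[ta]|].
  by move/(IH _ s0 ig g01); rewrite gE ta.
move=> b.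
(* The closed interval alone would allow [x^-1 = a + 1]; irrationality excludes it. *)
have ta : Num.truncn x^-1 = a.
  apply: truncn_def; have n1 := irrational_neq_nat a.+1 iV.
  move: b; rewrite /between -natr1 in n1 * => /orP[] /andP[b1 b2];
    by apply/andP; split; first lra; rewrite lt_neqAle n1 /=; lra.
by split => //; apply/(IH _ s0 ig g01); rewrite gE ta.
Qed.

Lemma countable_range_ratr : countable (range (@ratr R)).
Proof. exact: (sub_countable (card_image_le _ _) (countableP _)). Qed.

Lemma measurable_range_ratr : measurable (range (@ratr R)).
Proof.
by apply: countable_measurable; [move=> x; exact: measurable_set1 | exact: countable_range_ratr].
Qed.

Lemma cf_eval_inj s : injective (@cf_eval R s).
Proof. by elim: s => // a s IH x y /= /invr_inj /addrI /IH. Qed.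

Lemma integral_inv1D (a b : R) : 0 <= a -> a < b ->
  (\int[lebesgue_measure]_(x in `[a, b]) ((1 + x)^-1)%:E)%E =
  (ln (1 + b) - ln (1 + a))%:E.
Proof.
move=> a0 ab.
have dl x : 0 <= x -> is_derive x 1 (fun y : R => ln (1 + y)) (1 + x)^-1.
  by move=> x0; apply: is_derive_ln1D; lra.
have cl x : 0 <= x -> {for x, continuous (fun y : R => ln (1 + y))}.
  move=> x0; apply: differentiable_continuous; apply/derivable1_diffP.
  exact: (@ex_derive _ _ _ _ _ _ _ (dl x x0)).
have ci x : 0 <= x -> {for x, continuous (fun y : R => (1 + y)^-1)}.
  move=> x0; apply: cvgV; first by lra.
  by apply: cvgD; [exact: cvg_cst | exact: cvg_id].
rewrite (@continuous_FTC2 _ (fun x => (1 + x)^-1) (fun x => ln (1 + x))) //.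
- apply: continuous_in_subspaceT => x; rewrite inE /= in_itv /= => /andP[ax _].
  by apply: ci; lra.
- split.
  + move=> x; rewrite in_itv /= => /andP[ax _].
    by apply: ex_derive; apply: dl; lra.
  + by apply: cvg_at_right_filter; apply: cl.
  + by apply: cvg_at_left_filter; apply: cl; lra.
- move=> x; rewrite in_itv /= => /andP[ax _]; rewrite derive1E.
  by have x0 : 0 <= x; [lra | rewrite (derive_val (is_derive := dl x x0))].
Qed.

Lemma inv1D_measurable_fun :
  measurable_fun (`[(0 : R), 1]%classic) (fun x : R => (1 + x)^-1).
Proof.
apply: subspace_continuous_measurable_fun => //.
apply: continuous_in_subspaceT => x; rewrite inE /= in_itv /= => /andP[x0 _].
apply: cvgV; first by lra.
by apply: cvgD; [exact: cvg_cst | exact: cvg_id].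
Qed.

Lemma gauss_measure_cylinder s : all (fun d => 0 < d)%N s ->
  gauss_measure (cylinder s) = gauss_mass R s.
Proof.
move=> s0; pose N := range (@ratr R); pose C : set R := cylinder s.
have z01 : 0 <= (0 : R) <= 1 by rewrite lexx ler01.
have o01 : 0 <= (1 : R) <= 1 by rewrite lexx ler01.
pose u : R := cf_eval s 0; pose v : R := cf_eval s 1.
have /andP[u0 u1] : 0 <= u <= 1 := cf_eval_itv s0 z01.
have /andP[v0 v1] : 0 <= v <= 1 := cf_eval_itv s0 o01.
have uv : u != v.
  by rewrite (inj_eq (@cf_eval_inj s)) eq_sym oner_eq0.
pose lo := Num.min u v; pose hi := Num.max u v.
have lohi : lo < hi.
  by rewrite /lo /hi; case: (ltgtP u v) uv => //= -> ; rewrite eqxx.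
have lo0 : 0 <= lo by rewrite le_min u0.
have hi1 : hi <= 1 by rewrite ge_max u1.
have betE x : between u v x = (lo <= x <= hi).
  rewrite /between /lo /hi; have [h|h] := ltP u v.
    by rewrite orb_idr // => /andP[]; lra.
  by rewrite orb_idl // => /andP[]; lra.
have mN : measurable N := measurable_range_ratr.
pose I : set R := `[lo, hi]%classic.
have IE : I = [set y | lo <= y <= hi] by rewrite /I set_itvcc.
have CI : C `\` N = I `\` N.
  apply/seteqP; split => x [] h iN; split => //.
    have x01 : 0 <= x < 1 by case: h.
    by have /(cylinder_between s0 iN x01) := h; rewrite -/u -/v betE IE.
  have /andP[h1 h2] : lo <= x <= hi by move: h; rewrite IE.
  have x01 : 0 <= x < 1.
    rewrite (le_trans lo0 h1) /= lt_neqAle (irrational_neq_nat 1 iN) /=; lra.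
  by apply/(cylinder_between s0 iN x01); rewrite -/u -/v betE h1.
have mI : measurable I by apply: measurable_itv.
(* Discarding the null set of rationals requires measurability: [C] is an interval without its
   rationals, joined with a countable set. *)
have mC : measurable C.
  have -> : C = (I `\` N) `|` (C `&` N).
    by rewrite -CI setUC setUIDK.
  apply: measurableU; first exact: measurableD.
  apply: countable_measurable; first by move=> x; exact: measurable_set1.
  apply: sub_countable countable_range_ratr; by apply: subset_card_le => x [].
have CJ : C `<=` `[(0 : R), 1] by move=> x [/andP[x0 /ltW x1] _]; rewrite set_itvcc /= x0.
have IJ : I `<=` `[(0 : R), 1].
  move=> x; rewrite IE set_itvcc /= => /andP[h1 h2].
  by rewrite in_itv /= (le_trans lo0 h1) (le_trans h2 hi1).
pose f (x : R) : \bar R := ((1 + x)^-1)%:E.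
have f0 x : `[(0 : R), 1]%classic x -> (0 <= f x)%E.
  by rewrite set_itvcc /= => /andP[x0 _]; rewrite lee_fin invr_ge0; lra.
have mf (A : set R) : A `<=` `[(0 : R), 1] -> measurable_fun A f.
  move=> AJ; apply/measurable_EFinP.
  by apply: measurable_funS AJ inv1D_measurable_fun => //; exact: measurable_itv.
have N0 : lebesgue_measure N = 0%E := lebesgue_measure_rat R.
rewrite /gauss_measure -/C -/f.
have drop_rat (A : set R) : measurable A -> A `<=` `[(0 : R), 1] ->
    (\int[lebesgue_measure]_(x in A) f x = \int[lebesgue_measure]_(x in A `\` N) f x)%E.
  move=> mA AJ; apply: ge0_negligible_integral => //; first exact: mf.
  by move=> x /AJ; apply: f0.
rewrite drop_rat // CI -drop_rat //.
rewrite integral_inv1D //= mulrC /gauss_mass; congr (_ / _).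
(* Nonnegativity allows taking absolute values, which removes the sign without a split by parity. *)
have : 0 <= (-1) ^+ size s * (ln (1 + v) - ln (1 + u)).
  have /andP[+ _] := gauss_mass_itv R s0; rewrite /gauss_mass ler_pdivlMr ?mul0r //.
  by have := ln2_ge_half R; lra.
rewrite -/u -/v => h; rewrite -[RHS]ger0_norm // normrM normr_sign mul1r.
have lnle (a b : R) : 0 <= a -> a <= b -> ln (1 + a) <= ln (1 + b).
  by move=> a0 ab; rewrite ler_ln ?posrE; lra.
have [w|w] := ltP u v.
  by rewrite /lo /hi (max_r (ltW w)) (min_l (ltW w)) ger0_norm // subr_ge0 lnle // ltW.
by rewrite /lo /hi (max_l w) (min_r w) ler0_norm ?opprB // subr_le0 lnle.
Qed.

End CylinderMeasure.

(** * Existence of the number *)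


Section Existence.
Variable R : realType.
Implicit Types (x y : R) (w : seq nat) (d : nat -> nat).

Lemma cf_eval_sub w x y : all (fun a => 0 < a)%N w -> 0 <= x <= 1 -> 0 <= y <= 1 ->
  `|cf_eval w x - cf_eval w y| = `|x - y| * (cf_tails w x * cf_tails w y).
Proof.
move=> + x01 y01; elim: w => [|a w IH]; first by rewrite !cf_tails_nil !mulr1.
move=> /= /andP[a0 w0]; rewrite !cf_tails_cons /=.
have a1 := natr_ge1 R a0; have := IH w0.
have /andP[u0 u1] := cf_eval_itv w0 x01; have /andP[v0 v1] := cf_eval_itv w0 y01.
set u := cf_eval w x in u0 u1 *; set v := cf_eval w y in v0 v1 * => h.
rewrite (_ : _ - _ = - (u - v) * ((a%:R + u)^-1 * (a%:R + v)^-1)); last first.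
  by field; apply/andP; split; lra.
rewrite normrM normrN h [`|_ * (_ + v)^-1|]ger0_norm; first by ring.
by rewrite mulr_ge0 // invr_ge0; lra.
Qed.

Lemma cf_eval_sub_le w x y : all (fun a => 0 < a)%N w -> 0 <= x <= 1 -> 0 <= y <= 1 ->
  `|cf_eval w x - cf_eval w y| <= 2 * 2^-1 ^+ size w.
Proof.
move=> w0 x01 y01; rewrite cf_eval_sub //.
have xy : `|x - y| <= 1.
  by move: x01 y01 => /andP[? ?] /andP[? ?]; rewrite ler_norml; apply/andP; split; lra.
case: w w0 => [|a w] w0; first by rewrite !cf_tails_nil !mulr1; lra.
have bnd (t : R) : 0 <= t <= 1 -> cf_tails (a :: w) t ^+ 2 <= 2^-1 ^+ size w.
  move=> t01; apply: le_trans (cf_tails_le w0 t01) _.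
  by have /andP[e0 e1] := cf_eval_itv w0 t01; rewrite ler_piMl // exprn_ge0 // invr_ge0.
have := bnd _ x01; have := bnd _ y01.
have := ltW (cf_tails_gt0 w0 x01); have := ltW (cf_tails_gt0 w0 y01).
set p := cf_tails _ x; set q := cf_tails _ y => q0 p0 hq hp.
rewrite /= exprS mulrA mulfV ?mul1r ?pnatr_eq0 //.
have pq : p * q <= 2^-1 ^+ size w by have := sqr_ge0 (p - q); rewrite sqrrB; lra.
by apply: le_trans pq; rewrite ler_piMl // mulr_ge0.
Qed.

Lemma le_of_geometric (a b c : R) :
  (forall n, a <= b + c * 2^-1 ^+ n) -> a <= b.
Proof.
move=> h; apply/ler_addgt0Pl => e e0.
have [n hn] : exists n, `|c| * 2^-1 ^+ n <= e.
  have : (fun n => (2^-1 : R) ^+ n) @ \oo --> (0 : R).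
    by apply: cvg_expr; rewrite ger0_norm; lra.
  have e1 : 0 < e / (`|c| + 1) by rewrite divr_gt0 // ltr_wpDl.
  move=> /cvgrPdist_le /(_ _ e1) [n _ /(_ n (leqnn n))].
  have p0 : 0 <= 2^-1 ^+ n :> R by rewrite exprn_ge0 // invr_ge0.
  rewrite sub0r normrN ger0_norm // ler_pdivlMr ?ltr_wpDl // => hn.
  by exists n; apply: le_trans hn; rewrite mulrC ler_wpM2l // lerDl.
apply: le_trans (h n) _; rewrite addrC lerD2r; apply: le_trans hn.
by rewrite ler_wpM2r ?exprn_ge0 ?invr_ge0 // ler_norm.
Qed.

Definition cf_convergent d n : R := cf_eval (mkseq d n) 0.

(** The limit of the convergents, obtained by completeness as the supremum of lower bounds for
    it. *)
Definition cf_value d : R :=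
  sup [set cf_convergent d n - 2 * 2^-1 ^+ n | n in [set: nat]].

Lemma mkseq_pos d n : (forall i, 0 < d i)%N -> all (fun a => 0 < a)%N (mkseq d n).
Proof. by move=> d0; apply/allP => a /mapP[i _ ->]. Qed.

Lemma cf_convergent_itv d n : (forall i, 0 < d i)%N -> 0 <= cf_convergent d n <= 1.
Proof. by move=> d0; apply: cf_eval_itv; rewrite ?mkseq_pos // lexx ler01. Qed.

Lemma cf_convergent_sub_le d n m : (forall i, 0 < d i)%N -> (n <= m)%N ->
  `|cf_convergent d m - cf_convergent d n| <= 2 * 2^-1 ^+ n.
Proof.
move=> d0 nm; rewrite /cf_convergent -(subnKC nm) /mkseq iotaD map_cat cf_eval_cat.
have := @cf_eval_sub_le (mkseq d n) (cf_eval [seq d i | i <- iota n (m - n)] 0) 0.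
rewrite size_mkseq; apply; first exact: mkseq_pos.
  apply: cf_eval_itv; last by rewrite lexx ler01.
  by apply/allP => a /mapP[i _ ->].
by rewrite lexx ler01.
Qed.

Lemma cf_value_near d n : (forall i, 0 < d i)%N ->
  `|cf_value d - cf_convergent d n| <= 2 * 2^-1 ^+ n.
Proof.
move=> d0; set A := [set cf_convergent d n - 2 * 2^-1 ^+ n | n in [set: nat]].
have e0 k : 0 <= 2 * 2^-1 ^+ k :> R by rewrite mulr_ge0 // exprn_ge0 // invr_ge0.
have ubA k : ubound A (cf_convergent d k + 2 * 2^-1 ^+ k).
  move=> _ [j _ <-].
  have : `|cf_convergent d j - cf_convergent d k| <= 2 * 2^-1 ^+ j + 2 * 2^-1 ^+ k.
    have [jk|kj] := leqP j k.
      by rewrite distrC; apply: le_trans (cf_convergent_sub_le d0 jk) _; rewrite lerDl.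
    by apply: le_trans (cf_convergent_sub_le d0 (ltnW kj)) _; rewrite lerDr.
  by rewrite ler_norml => /andP[]; lra.
have hs : has_sup A.
  split; first by exists (cf_convergent d 0 - 2 * 2^-1 ^+ 0), 0%N.
  by exists (cf_convergent d 0 + 2 * 2^-1 ^+ 0); apply: ubA.
have up : cf_value d <= cf_convergent d n + 2 * 2^-1 ^+ n.
  by apply: ge_sup; [case: hs | exact: ubA].
have dn : cf_convergent d n - 2 * 2^-1 ^+ n <= cf_value d.
  by apply: ub_le_sup; [case: hs | exists n].
by rewrite ler_norml; apply/andP; split; lra.
Qed.

Lemma cf_value_itv d : (forall i, 0 < d i)%N -> 0 <= cf_value d <= 1.
Proof.
move=> d0; apply/andP; split; apply: (@le_of_geometric _ _ 2) => n;
  have := cf_value_near n d0; have /andP[] := cf_convergent_itv n d0;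
  by rewrite ler_norml => ? ? /andP[]; lra.
Qed.

(** Inherited from the convergents, with an error [3 * 2^-1 ^+ n] for every [n]. *)
Lemma cf_value_step d : (forall i, 0 < d i)%N ->
  cf_value d = ((d 0%N)%:R + cf_value (fun i => d i.+1))^-1.
Proof.
move=> d0; set d' := fun i => d i.+1; have d'0 i : (0 < d' i)%N by apply: d0.
have /andP[v0 v1] := cf_value_itv d'0; have a1 := natr_ge1 R (d0 0%N).
suff h n : `|cf_value d - ((d 0%N)%:R + cf_value d')^-1| <= 0 + 3 * 2^-1 ^+ n.
  by apply/eqP; rewrite -subr_eq0 -normr_le0; apply: le_of_geometric h.
rewrite add0r.
have := cf_value_near n.+1 d0; have := cf_value_near n d'0.
have -> : cf_convergent d n.+1 = ((d 0%N)%:R + cf_convergent d' n)^-1.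
  by rewrite /cf_convergent /mkseq /= -[1%N]addn0 iotaDl -map_comp.
have /andP[c0 c1] := cf_convergent_itv n d'0.
set c := cf_convergent d' n in c0 c1 *; set v := cf_value d' in v0 v1 *.
set a : R := (d 0%N)%:R in a1 *; set x := cf_value d; rewrite exprS => h1 h2.
have h3 : `|(a + c)^-1 - (a + v)^-1| <= 2 * 2^-1 ^+ n.
  rewrite (_ : _ - _ = (v - c) * ((a + c)^-1 * (a + v)^-1)); last first.
    by field; apply/andP; split; lra.
  rewrite normrM; apply: le_trans h1; rewrite ler_piMr //.
  rewrite ger0_norm ?mulr_ge0 ?invr_ge0 //; try lra.
  by rewrite mulr_ile1 ?invr_ge0 ?invf_le1 //; lra.
rewrite -(subrK (a + c)^-1 x) -addrA; apply: le_trans (ler_normD _ _) _.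
lra.
Qed.

(** Positivity of the shifted value gives a value below 1, so the integer part of the inverse is
    exactly [d 0] and [gauss] shifts [d]. The orbit never reaches 0, hence no digit is split. *)
Lemma cf_value_has_cf d : (forall i, 0 < d i)%N -> has_cf (cf_value d) d.
Proof.
have gt0 d' : (forall i, 0 < d' i)%N -> 0 < cf_value d'.
  move=> d0; rewrite cf_value_step // invr_gt0.
  have := natr_ge1 R (d0 0%N).
  have /andP[] := @cf_value_itv (fun i => d' i.+1) (fun i => d0 i.+1); lra.
have lt1 d' : (forall i, 0 < d' i)%N -> cf_value d' < 1.
  move=> d0; rewrite cf_value_step // invf_lt1.
    have := natr_ge1 R (d0 0%N).
    have := gt0 (fun i => d' i.+1) (fun i => d0 i.+1); lra.
  have := natr_ge1 R (d0 0%N).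
  have := gt0 (fun i => d' i.+1) (fun i => d0 i.+1); lra.
have tr d' : (forall i, 0 < d' i)%N -> Num.truncn (cf_value d')^-1 = d' 0%N.
  move=> d0; rewrite cf_value_step // invrK; apply: truncn_def.
  have := gt0 (fun i => d' i.+1) (fun i => d0 i.+1).
  have := lt1 (fun i => d' i.+1) (fun i => d0 i.+1).
  by rewrite -natr1 => h1 h2; apply/andP; split; lra.
have ga d' : (forall i, 0 < d' i)%N -> gauss (cf_value d') = cf_value (fun i => d' i.+1).
  move=> d0; rewrite /gauss gt_eqF ?gt0 // tr // cf_value_step // invrK.
  by rewrite addrAC subrr add0r.
move=> d0; split; first by rewrite (ltW (gt0 _ d0)) lt1.
have orb i : gauss_orbit (cf_value d) i = cf_value (fun j => d (i + j)%N).
  elim: i => [|i IH] //; rewrite /gauss_orbit iterS -/(gauss_orbit _ _) IH ga //.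
  by congr cf_value; apply/funext => j; rewrite addnS.
move=> i; rewrite /cf_digit orb.
have di j : (0 < d (i + j))%N by [].
rewrite gt_eqF ?gt0 //= ga // gt_eqF ?gt0 //.
by rewrite (tr (fun j => d (i + j)%N)) // addn0.
Qed.

Lemma concat_prefix_cat k Q Q' : (Q <= Q')%N ->
  exists l, concat_prefix R k Q' = concat_prefix R k Q ++ l.
Proof.
move=> /subnKC <-; elim: (Q' - Q)%N => [|n [l IH]].
  by exists [::]; rewrite addn0 cats0.
rewrite addnS; case: (Q + n)%N IH => [|a] IH.
  by exists l; rewrite -IH.
have [l' hl'] := rat_words_recr R k a; exists (l ++ flatten l').
by rewrite catA -IH !concat_prefixE hl' flatten_cat.
Qed.

(** Longer prefixes extend shorter ones, so [d i] may be read off any prefix with more than [i]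
    entries. *)
Lemma exists_concat k : exists2 d, is_concat R k d & forall i, (0 < d i)%N.
Proof.
pose Qof i := projT1 (cid (concat_prefix_unbounded R k i)).
have QofP i : (i < size (concat_prefix R k (Qof i)))%N.
  exact: (projT2 (cid (concat_prefix_unbounded R k i))).
pose d i := nth 0%N (concat_prefix R k (Qof i)) i.
exists d.
  move=> Q i iQ; rewrite /d.
  have [h|/ltnW h] := leqP (Qof i) Q; have [l hl] := concat_prefix_cat k h.
    by rewrite hl nth_cat QofP.
  by rewrite hl nth_cat iQ.
move=> i; rewrite /d.
have : nth 0%N (concat_prefix R k (Qof i)) i \in concat_prefix R k (Qof i).
  exact: mem_nth.
rewrite {2}concat_prefixE => /flattenP[w /mem_rat_words[ww _ _ _ _]] iw.
exact: (allP (words_pos ww)).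
Qed.

End Existence.

Theorem theorem1p4 (R : realType) (k : subseq_kind) :
  (exists (d : nat -> nat) (x : R), is_concat R k d /\ has_cf x d) /\
  (forall (d : nat -> nat) (x : R), is_concat R k d -> has_cf x d -> cf_normal x).
Proof.
split.
  have [d dc d0] := exists_concat R k.
  by exists d, (cf_value R d); split => //; apply: cf_value_has_cf.
move=> d x dc dx s s0 /=; rewrite gauss_measure_cylinder //.
(* The block argument needs a nonempty string; the empty one occurs at every position and has mass
   1. *)
case: s s0 => [_|a s s0]; last exact: (occ_cvg dc dx).
have l2 : ln 2 != 0 :> R by have := ln2_ge_half R => h; apply/eqP; lra.
have -> : gauss_mass R [::] = 1.
  by rewrite /gauss_mass /= mul1r addr0 ln1 subr0 -[1 + 1]/2 divff.
apply/cvgrPdist_le => e e0; exists 1%N => // N /= N1.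
rewrite /occ (eq_count (a2 := predT)) // count_predT size_iota divff.
  by rewrite subrr normr0 ltW.
by rewrite pnatr_eq0 -lt0n.
Qed.
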